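(* Let $Q$ be a 2-connected quiver. Consider the Stanley–Reisner ring $\mathbb{Q}[\Delta]$ associated to the order complex $\Delta$ of the poset $(\Pi(Q_1)\setminus\{\emptyset,Q_1\},\subseteq)$, and its fine Hilbert series $\mathrm{Hilb}_\Delta$. Then $$A_Q(q)=\frac{(1-q^{-1})^{b(Q)}}{1-q^{-b(Q)}}\cdot\mathrm{Hilb}_{\Delta}\left(u_E=q^{-(b(Q)-b(Q\restriction_E))}\right),$$ and $\mathrm{Hilb}_{\Delta}\left(u_E=q^{-(b(Q)-b(Q\restriction_E))}\right)$ can be presented as a rational fraction whose numerator has non-negative coefficients.
   Context: A quiver $Q=(Q_0,Q_1,s,t)$ consists of finite sets of vertices $Q_0$ and arrows $Q_1$ with source and target maps $s,t:Q_1\to Q_0$. $Q$ is 2-connected if its underlying graph is connected and removing one edge does not disconnect it. The Betti number of a quiver with $C$ connected components, $V$ vertices and $N$ arrows is $C-V+N$; for $Q$ it is denoted $b(Q)$. For $E\subseteq Q_1$, $Q\restriction_E$ is the quiver with vertex set $Q_0$ and arrow set $E$. $A_Q(q)=\lim_{\alpha\to+\infty}q^{-\alpha b(Q)}A_{Q,\underline{1},\alpha}(q)$ for $q$ a prime power, where $A_{Q,\underline{1},\alpha}(q)$ is the number of isomorphism classes of absolutely indecomposable locally free representations of $Q$ of rank $\underline{1}=(1,\dots,1)$ over $\mathbb{F}_q[t]/(t^\alpha)$. (Such a representation is a collection of free rank one modules $M_i$, $i\in Q_0$, with linear maps $f_a:M_{s(a)}\to M_{t(a)}$, $a\in Q_1$;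 it is absolutely indecomposable if after base change to $\overline{\mathbb{F}_q}[t]/(t^\alpha)$ it is not a direct sum of two nonzero subrepresentations.) For 2-connected $Q$ this limit is known to exist and to be a rational fraction in $q$ (Wyss): $A_Q(q)=(1-q^{-1})^{b(Q)}\sum_{E_1\subsetneq E_2\subsetneq\ldots\subsetneq E_s=Q_1}\prod_{j=1}^{s-1}\frac{1}{q^{b(Q)-b(Q\restriction_{E_j})}-1}$, the sum running over all strict chains of subsets of $Q_1$ ending at $Q_1$ ($E_1=\emptyset$ allowed). $\Pi(Q_1)$ is the poset of subsets of $Q_1$ ordered by inclusion. The order complex of a poset is the simplicial complex whose vertices are the elements of the poset and whose faces are its finite chains (including the empty chain). For a simplicial complex $\Delta$ on a finite vertex set $V$, $\mathbb{Q}[\Delta]=\mathbb{Q}[x_v,v\in V]/I_\Delta$, where $I_\Delta$ is generated by the squarefree monomials whose support is not a face; it is $\mathbb{Z}_{\geq0}^V$-graded, and its fine Hilbert series is $\mathrm{Hilb}_\Delta(u)=\sum_{\mathbf{m}\in\mathbb{Z}_{\geq0}^V}\dim_{\mathbb{Q}}\mathbb{Q}[\Delta]_{\mathbf{m}}\,u^{\mathbf{m}}=\sum_{F\in\Delta}\prod_{v\in F}\frac{u_v}{1-u_v}$. Here the variables $u_E$ are indexed by the vertices of $\Delta$, i.e. the subsets $\emptyset\neq E\subsetneq Q_1$. *)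

(* Defs.v *)
From HB Require Import structures.
From mathcomp Require Import all_boot all_order all_algebra all_field.
From mathcomp Require Import finmap monalg.
From mathcomp Require Import all_classical all_reals all_analysis.

Set Implicit Arguments.
Unset Strict Implicit.
Unset Printing Implicit Defensive.

Import Order.TTheory GRing.Theory Num.Theory.
Import numFieldNormedType.Exports.

Local Open Scope classical_set_scope.
Local Open Scope ring_scope.

Record quiver := Quiver {
  vert : finType;
  arr : finType;
  src : arr -> vert;
  tgt : arr -> vert
}.
Arguments src {q} _.
Arguments tgt {q} _.

Definition subquiver (Q : quiver) (E : {set arr Q}) : quiver :=
  @Quiver (vert Q) {a : arr Q | a \in E}
    (fun a => src (val a)) (fun a => tgt (val a)).

Definition adjacent (Q : quiver) : rel (vert Q) := fun i j =>
  [exists a : arr Q, ((src a == i) && (tgt a == j))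
                  || ((src a == j) && (tgt a == i))].

Definition ncomponents (Q : quiver) : nat := n_comp (@adjacent Q) predT.

Definition betti (Q : quiver) : int :=
  (ncomponents Q)%:Z - #|vert Q|%:Z + #|arr Q|%:Z.

Definition quiver_connected (Q : quiver) : Prop := ncomponents Q = 1%N.

Definition two_connected (Q : quiver) : Prop :=
  quiver_connected Q /\
  forall a : arr Q, quiver_connected (subquiver [set~ a]%SET).

(* Free modules are taken in the standard form M_i = S^(r i) (row vectors), and
   the linear map attached to an arrow a is x |-> x *m M a. *)
Definition rep (Q : quiver) (r : vert Q -> nat) (S : Type) : Type :=
  {dffun forall a : arr Q, 'M[S]_(r (src a), r (tgt a))}.

Definition rep_iso (Q : quiver) (r : vert Q -> nat) (S : comUnitRingType)
    (M N : rep r S) : Prop :=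
  exists g : forall i : vert Q, 'M[S]_(r i),
    (forall i, g i \in unitmx) /\
    (forall a : arr Q, M a *m g (tgt a) = g (src a) *m N a).

Section Indecomposable.
Context (Q : quiver) (r : vert Q -> nat) (S : comNzRingType) (M : rep r S).

Definition is_subrep (U : forall i : vert Q, {pred 'rV[S]_(r i)}) : Prop :=
  (forall i, submod_closed (U i)) /\
  (forall (a : arr Q) x, x \in U (src a) -> x *m M a \in U (tgt a)).

Definition nonzero_subrep (U : forall i : vert Q, {pred 'rV[S]_(r i)}) : Prop :=
  exists i, exists2 x, x \in U i & x != 0.

Definition is_direct_sum (U W : forall i : vert Q, {pred 'rV[S]_(r i)}) : Prop :=
  forall i,
    (forall x, exists u w, [/\ u \in U i, w \in W i & x = u + w]) /\
    (forall x, x \in U i -> x \in W i -> x = 0).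

Definition indecomposable : Prop :=
  ~ exists U W, [/\ is_subrep U /\ is_subrep W,
                    nonzero_subrep U, nonzero_subrep W & is_direct_sum U W].

End Indecomposable.

(* K[t]/(t^alpha), for alpha >= 1.  For alpha = 0 the library quotients by 'X
   instead; this does not affect limits in alpha. *)
Definition trunc (K : fieldType) (alpha : nat) := {poly %/ ('X^alpha : {poly K})}.

Definition alg_closure (F : finFieldType) : countClosedFieldType :=
  projT1 (countable_algebraic_closure F).

Definition to_alg_closure (F : finFieldType) : {rmorphism F -> alg_closure F} :=
  sval (projT2 (countable_algebraic_closure F)).

Definition trunc_map (F K : fieldType) (f : {rmorphism F -> K}) (alpha : nat)
    (x : trunc F alpha) : trunc K alpha :=
  in_qpoly 'X^alpha (map_poly f (x : {poly F})).

Definition base_change (Q : quiver) (r : vert Q -> nat) (F K : fieldType)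
    (f : {rmorphism F -> K}) (alpha : nat) (M : rep r (trunc F alpha)) :
    rep r (trunc K alpha) :=
  [ffun a => map_mx (@trunc_map F K f alpha) (M a)].

Definition abs_indecomposable (Q : quiver) (r : vert Q -> nat)
    (F : finFieldType) (alpha : nat) (M : rep r (trunc F alpha)) : Prop :=
  indecomposable (base_change (to_alg_closure F) M).

Definition num_abs_indec (Q : quiver) (r : vert Q -> nat) (alpha : nat)
    (F : finFieldType) : nat :=
  #|[set [set N : rep r (trunc F alpha) | `[< rep_iso M N >]]
    | M : rep r (trunc F alpha) in [set M | `[< abs_indecomposable M >]]]%SET|.

Definition normalized_count (R : realType) (Q : quiver) (F : finFieldType) :
    R^nat := fun alpha =>
  (#|F|%:R : R) ^ (- (alpha%:Z * betti Q))
  * (num_abs_indec (fun _ : vert Q => 1%N) alpha F)%:R.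

(* The value of A_Q at the prime power q = #|F|. *)
Definition A_Q (R : realType) (Q : quiver) (F : finFieldType) : R :=
  limn (normalized_count R Q F).

Section StanleyReisner.
Context (V : finType) (Delta : {set {set V}}).

(* rat[x_v, v in V]; the exponent vectors are the elements of {cmonom V}. *)
Definition polyring := {malg rat[{cmonom V}]}.

Definition squarefree_monomial (C : {set V}) : polyring :=
  \prod_(v in C) << ucm v >>.

Definition SR_ideal : set polyring := [set p |
  exists c : {set V} -> polyring,
    p = \sum_(C : {set V} | C \notin Delta) c C * squarefree_monomial C].

Definition homogeneous_piece (m : {cmonom V}) : set polyring :=
  [set p | exists c : rat, p = << c *g m >>].

(* W / (W `&` I) has dimension n. *)
Definition has_dim_mod (I W : set polyring) (n : nat) : Prop :=
  exists b : 'I_n -> polyring,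
    [/\ forall i, W (b i),
        forall c : 'I_n -> rat, I (\sum_i c i *: b i) -> forall i, c i = 0
      & forall w, W w -> exists c : 'I_n -> rat, I (w - \sum_i c i *: b i)].

(* The degree m piece of rat[x_v] / SR_ideal is the image of the degree m piece
   of rat[x_v]. *)
Definition SR_dim (m : {cmonom V}) : nat :=
  xget 0%N [set n | has_dim_mod SR_ideal (homogeneous_piece m) n].

(* The value of the fine Hilbert series at a point with non-negative
   coordinates, possibly +oo. *)
Definition fine_Hilb (R : realType) (u : V -> R) : \bar R :=
  (\esum_(m in [set: {cmonom V}])
     ((SR_dim m)%:R * \prod_(v : V) u v ^+ (m : {cmonom V}) v)%:E)%E.

End StanleyReisner.

Definition order_complex (V : finType) (le : rel V) : {set {set V}} :=
  [set C : {set V} | [forall x in C, forall y in C, le x y || le y x]]%SET.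

Definition proper_part (T : finType) : finType :=
  {E : {set T} | (E != finset.set0) && (E != finset.setTfor T)}.

Definition proper_subsets_complex (Q : quiver) : {set {set proper_part (arr Q)}} :=
  order_complex (fun E E' : proper_part (arr Q) => val E \subset val E').

(* The specialization u_E = q^(-(b(Q) - b(Q|_E))). *)
Definition Hilb_at (R : realType) (Q : quiver) (q : R) : \bar R :=
  fine_Hilb (proper_subsets_complex Q) (fun E : proper_part (arr Q) =>
    q ^ (- (betti Q - betti (subquiver (val E))))).

(* Main.v *)
Require Import Defs.
From HB Require Import structures.
From mathcomp Require Import all_boot all_order all_algebra.
From mathcomp Require Import finmap monalg.
From mathcomp Require Import all_classical all_reals all_analysis.
From mathcomp Require Import zify ring lra.
(* The names of the finite-set libraries take precedence over those for
   classical sets. *)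
From mathcomp Require Import fintype finset.

Set Implicit Arguments.
Unset Strict Implicit.
Unset Printing Implicit Defensive.

Import Order.TTheory GRing.Theory Num.Theory.
Import numFieldNormedType.Exports.

Local Open Scope classical_set_scope.
Local Open Scope ring_scope.

(** Write S for F[t]/(t^(n+1)) and b for the Betti number of Q.  A representation
    of rank (1, ..., 1) over S is a family of scalars x_a, one for each arrow, and
    isomorphisms are gauge transformations by families of units g_i.  As S is
    local, the representation is absolutely indecomposable exactly when the arrows
    with x_a <> 0 connect the vertices ([abs_indecomposable_rank1]).

    The number of orbits is the sum over x of #Stab(x) divided by the order of the
    gauge group ([card_iso_classes]).  The unit family g fixes x when
    x_a (g_s(a) - g_t(a)) = 0, which says that g_s(a) and g_t(a) agree in their
    first l(x_a) coefficients, where l(x_a) is the length of the ideal (x_a)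
    ([trunc_mul_eq0]).  So coefficient k of g is a function on the vertices that is
    constant along the arrows of E_k = {a | k < l(x_a)}, and there are
    q^(number of components of E_k) such functions ([card_const_along]); for k = 0
    the values are moreover non-zero, because g is a family of units.  Counting the
    x with given lengths as well, all powers of q collect into Betti numbers
    and the normalized count becomes
      sum over E_0 >= E_1 >= ... >= E_n, with E_0 connected, of
        (1 - 1/q)^b(E_0) * u(E_0) * ... * u(E_n),   u(E) = q^(b(E) - b)
    ([normalized_countE]).  For a 2-connected quiver, u(E) < 1 unless E is the set
    of all arrows ([betti_proper]), so in the limit only E_0 = Q_1 survives, and
    what remains is the sum over all multichains of proper subsets, the empty set
    included ([cvg_multichain_setT]).  Collecting equal members of a multichain,
    this is the sum over chains of proper subsets of the products of u/(1 - u); the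
    empty set, which can be inserted at the bottom of any chain, contributes the
    factor 1/(1 - q^(-b)).

    On the other side, a monomial of the Stanley-Reisner ring is non-zero exactly
    when its support is a face ([SR_dimE]), and summing geometric series turns the
    fine Hilbert series into the same sum over chains of non-empty proper subsets
    ([fine_HilbE], [Hilb_atE]).

    For the non-negativity, put w = u/(1 - u).  Fix a total order on the arrows and
    refine a chain to a flag by adding the elements of each block in increasing
    order.  Every flag arises from the chains that contain its descent positions,
    so the chain sum is the sum over the permutations of Q_1 of the products of w
    over descents and of w + 1 over ascents.  With w = 1/(q^d - 1) and a common
    multiple D of the exponents d, both w (q^D - 1) and (w + 1) (q^D - 1) are
    polynomials in q with non-negative coefficients, so the power |Q_1| - 1 of
    q^D - 1 is a denominator with non-negative numerator.  The permutations are
    removed one element at a time by the recursion [top_sum_rec]. *)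

(** * Chains of subsets and their recursion *)

Section ChainSum.
Context (T : finType) (R : comNzRingType) (w : {set T} -> R).

Let V := proper_part T.
Let Delta : {set {set V}} :=
  order_complex (fun X Y : V => val X \subset val Y).

Definition chain_sum (E : {set T}) : R :=
  \sum_(C in Delta | [forall X in C, val X \proper E]) \prod_(X in C) w (val X).

(** The only property of chain sums on which the numerator and the limit depend. *)
Definition chain_recursion (h : {set T} -> R) :=
  forall E, h E = 1 + \sum_(X : {set T} | (X != set0) && (X \proper E)) w X * h X.

Definition is_largest (X : V) (C : {set V}) :=
  (X \in C) && [forall Y in C, val Y \subset val X].

Lemma is_largest_uniq C X Y : is_largest X C -> is_largest Y C -> X = Y.
Proof.
move=> /andP[XC /forall_inP hX] /andP[YC /forall_inP hY].
by apply/val_inj/eqP; rewrite eqEsubset hX // hY.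
Qed.

Lemma largest_exists C : C \in Delta -> C != set0 -> exists X, is_largest X C.
Proof.
rewrite inE => /forall_inP hC /set0Pn[X0 X0C].
have [X XC hX] := arg_maxnP (fun Y : V => #|val Y|) X0C.
exists X; apply/andP; split=> //; apply/forall_inP => Y YC.
have /forall_inP/(_ X XC)/orP[//|XY] := hC Y YC.
have /eqP -> // : val X == val Y by rewrite eqEcard XY; apply: hX.
Qed.

(** A non-empty chain is its largest member X together with a chain of subsets
    strictly contained in X. *)
Lemma chain_sumE : chain_recursion chain_sum.
Proof.
move=> E; rewrite /chain_sum.
rewrite (bigD1 set0) /=; last first.
  by apply/andP; split; [rewrite inE|]; apply/forall_inP => X; rewrite inE.
rewrite big_set0; congr (_ + _).
pose F (C : {set V}) := \prod_(X in C) w (val X).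
transitivity (\sum_(C | [&& C \in Delta, [forall X in C, val X \proper E]
    & C != set0]) \sum_(X : V | is_largest X C) F C).
  rewrite [LHS](eq_bigl (fun C => [&& C \in Delta, [forall X in C, val X \proper E]
    & C != set0])); last by move=> C; rewrite andbA.
  apply: eq_bigr => C /and3P[CD _ C0].
  have [X XC] := largest_exists CD C0.
  rewrite [RHS](eq_bigl (pred1 X)) ?big_pred1_eq // => Y /=.
  by apply/idP/eqP => [/is_largest_uniq/(_ XC)|->].
rewrite (exchange_big_dep (fun X : V => val X \proper E)) /=; last first.
  by move=> C X /and3P[_ /forall_inP h _] /andP[XC _]; apply: h.
rewrite (reindex_omap (val : V -> {set T}) insub) /=; last first.
  move=> X /andP[X0 XE]; rewrite insubT //= X0 /=.
  by apply: contraTneq XE => ->; rewrite properE subsetT andbF.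
rewrite [RHS](eq_bigl (fun X : V => val X \proper E)); last first.
  by move=> X; rewrite [insub _](valK X) eqxx andbT; case: X => X /= /andP[-> _].
apply: eq_bigr => X XE; rewrite big_distrr /=.
rewrite (reindex_onto (fun C : {set V} => X |: C) (fun C => C :\ X))%SET /=; last first.
  by move=> C /andP[_ /andP[XC _]]; rewrite setD1K.
apply: eq_big => [C|C].
  apply/idP/idP.
    move=> /andP[/andP[/and3P[CD /forall_inP hC _] /andP[_ /forall_inP hX]]].
    move=> /eqP eC; have XC : X \notin C by rewrite -eC !inE eqxx.
    apply/andP; split; last first.
      apply/forall_inP => Y YC; rewrite properEneq hX ?inE ?YC ?orbT // andbT.
      by apply: contraNneq XC => /val_inj <-.
    move: CD; rewrite !inE => /forall_inP CD; apply/forall_inP => Y YC.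
    apply/forall_inP => Z ZC.
    by have /forall_inP := CD Y (setU1r _ YC); apply; apply: setU1r.
  move=> /andP[CD /forall_inP hC].
  have XC : X \notin C by apply/negP => /hC; rewrite properxx.
  rewrite setU1K // eqxx andbT; apply/andP; split; last first.
    rewrite /is_largest setU11 /=; apply/forall_inP => Y; rewrite !inE.
    by move=> /orP[/eqP -> //|/hC /proper_sub].
  apply/and3P; split; last by apply/set0Pn; exists X; rewrite setU11.
    rewrite inE; apply/forall_inP => Y; rewrite !inE => YC; apply/forall_inP => Z.
    rewrite !inE => ZC; case/orP: YC => [/eqP->|YC]; case/orP: ZC => [/eqP->|ZC].
    - by rewrite subxx.
    - by rewrite (proper_sub (hC _ ZC)) orbT.
    - by rewrite (proper_sub (hC _ YC)).
    - by move: CD; rewrite inE => /forall_inP /(_ Y YC) /forall_inP /(_ Z ZC).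
  apply/forall_inP => Y; rewrite !inE => /orP[/eqP -> //|/hC YX].
  exact: proper_trans XE.
move=> /andP[_ /eqP eC]; have XC : X \notin C by rewrite -eC !inE eqxx.
by rewrite /F big_setU1.
Qed.

End ChainSum.

(** * Non-negativity of the numerator *)

Section TopElement.
Context (T : finType).

(** The total order on [T] is that of its enumeration. *)
Definition is_top (a : T) (D : {set T}) :=
  (a \in D) && [forall b in D, (enum_rank b <= enum_rank a)%N].

Lemma is_top_uniq D a b : is_top a D -> is_top b D -> a = b.
Proof.
move=> /andP[aD /forall_inP ha] /andP[bD /forall_inP hb].
by apply/enum_rank_inj/val_inj/eqP; rewrite eqn_leq ha // hb.
Qed.

Lemma top_exists D : D != set0 -> exists a, is_top a D.
Proof.
move=> /set0Pn[a0 a0D].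
have [a aD ha] := arg_maxnP (fun b : T => enum_rank b) a0D.
by exists a; apply/andP; split=> //; apply/forall_inP.
Qed.

Lemma is_top_setD (E X : {set T}) a b : a \in E -> X \subset (E :\ a)%SET ->
  is_top b ((E :\ a) :\: X)%SET ->
  is_top a (E :\: X)%SET = (enum_rank b < enum_rank a)%N.
Proof.
move=> aE XE; rewrite /is_top => /andP[]; rewrite !inE => /and3P[bX ba bE].
move=> /forall_inP hb.
have aX : a \notin X by apply/negP => /(subsetP XE); rewrite !inE eqxx.
rewrite aE aX /=; apply/forall_inP/idP => [ha|ba' c].
  rewrite ltn_neqAle ha ?inE ?bX // andbT.
  by apply: contraNneq ba => /val_inj/enum_rank_inj ->.
rewrite !inE => /andP[cX cE]; have [->//|ca] := eqVneq c a.
by apply: leq_trans (ltnW ba'); apply: hb; rewrite !inE cX ca.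
Qed.

End TopElement.

Section Descents.
Context (T : finType) (R : comNzRingType) (w h : {set T} -> R).
Context (hrec : chain_recursion w h).

Let g (X : {set T}) := if X == set0 then 1 else w X * h X.

(** The part of the chain sum of [E] that comes from the chains whose last block,
    the complement in [E] of the largest member (all of [E] for the empty chain),
    has largest element [a]. *)
Definition top_sum (E : {set T}) (a : T) : R :=
  \sum_(X : {set T} | (X \proper E) && is_top a (E :\: X)%SET) g X.

(** Every last block is non-empty and has exactly one largest element. *)
Lemma sum_by_top (P : pred {set T}) (E : {set T}) :
  (forall X, P X -> X \proper E) ->
  \sum_(X | P X) g X
  = \sum_(a in E) \sum_(X | P X && is_top a (E :\: X)%SET) g X.
Proof.
move=> PE; rewrite (exchange_big_dep P) /=; last by move=> a X _ /andP[].
apply: eq_bigr => X PX.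
have [|a ha] := @top_exists _ (E :\: X)%SET.
  by move: (PE _ PX); rewrite properE setD_eq0 => /andP[].
rewrite (eq_bigl (pred1 a)) ?big_pred1_eq // => b /=.
apply/andP/eqP => [[_ /andP[_ /is_top_uniq/(_ ha)]] //|->].
by rewrite PX ha; split=> //; case/andP: ha; rewrite inE => /andP[].
Qed.

Lemma sum_top_sums E : E != set0 -> h E = \sum_(a in E) top_sum E a.
Proof.
move=> E0; rewrite hrec // -(@sum_by_top (fun X => X \proper E)) //.
rewrite [RHS](bigD1 set0) ?proper0 //= /g eqxx; congr (_ + _).
by apply: eq_big => [X|X /andP[/negbTE ->] //]; rewrite andbC.
Qed.

(** Unfolded, this writes the chain sum as a sum over permutations: the element
    [a] is listed last and [b] last but one, with a factor [w] at a descent and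
    [w + 1] at an ascent.  Either [E :\ a] is itself the largest member of the
    chain, which is the summand [w], or removing [a] from the last block leaves a
    non-empty block whose largest element [b] is below [a], which is the extra
    [1].  No cancellation is left, which is what positivity needs. *)
Lemma top_sum_rec (E : {set T}) a : a \in E ->
  top_sum E a = if (E :\ a)%SET == set0 then 1 else
  \sum_(b in (E :\ a)%SET)
     (w (E :\ a)%SET + (enum_rank b < enum_rank a)%N%:R) * top_sum (E :\ a)%SET b.
Proof.
move=> aE; rewrite /top_sum.
have topa : is_top a (E :\: (E :\ a))%SET.
  rewrite setDDr setDv set0U /is_top !inE aE eqxx /=; apply/forall_inP => b.
  by rewrite !inE => /andP[_ /eqP ->].
rewrite (bigD1 (E :\ a)%SET) /=; last by rewrite properD1 // topa.
rewrite (eq_bigl (fun X : {set T} =>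
  (X \proper (E :\ a)%SET) && is_top a (E :\: X)%SET)); last first.
  move=> X; rewrite andbC andbA [X \proper (_ :\ _)%SET]properEneq.
  have [//|XEa /=] := eqVneq X (E :\ a)%SET; rewrite /=.
  apply/andP/andP => -[h1 h2]; split=> //.
    rewrite subsetD1 proper_sub //=; case/andP: h2; rewrite inE => /andP[//].
  by apply: sub_proper_trans h1 _; rewrite properD1.
have [E0|E0] := eqVneq; rewrite {1}/g.
  rewrite E0 eqxx big_pred0 ?addr0 // => X; rewrite properE.
  by apply/negP => /andP[/andP[_]]; rewrite sub0set.
rewrite (negbTE E0) sum_top_sums // big_distrr /=.
rewrite (@sum_by_top _ (E :\ a)%SET); last by move=> X /andP[].
rewrite -big_split /=; apply: eq_bigr => b bE; rewrite mulrDl; congr (_ + _).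
rewrite /top_sum big_distrr /=; rewrite big_mkcond [RHS]big_mkcond /=.
apply: eq_bigr => X _; case: (boolP (X \proper _)) => //= XE.
case: (boolP (is_top b _)) => tb; last by rewrite andbF.
rewrite andbT (is_top_setD aE (proper_sub XE) tb).
by case: ltnP => _; rewrite ?mul1r ?mul0r.
Qed.
End Descents.

Definition nonneg_coefs (N : {poly int}) := forall i, 0 <= N`_i.

Lemma nonneg_coefs_sum (I : finType) (P : pred I) (N : I -> {poly int}) :
  (forall i, P i -> nonneg_coefs (N i)) -> nonneg_coefs (\sum_(i | P i) N i).
Proof. by move=> hN k; rewrite coef_sum sumr_ge0 // => i /hN. Qed.

Lemma nonneg_coefsM N M :
  nonneg_coefs N -> nonneg_coefs M -> nonneg_coefs (N * M).
Proof. by move=> hN hM k; rewrite coefM sumr_ge0 // => i _; rewrite mulr_ge0. Qed.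

Lemma nonneg_coefsXn n : nonneg_coefs 'X^n.
Proof. by move=> k; rewrite coefXn ler0n. Qed.

Section NonnegativeNumerator.
Context (R : realType) (T : finType) (d : {set T} -> nat).
Context (d_gt0 : forall X : {set T}, X \proper setT -> (0 < d X)%N).

Definition geom_weight (q : R) (X : {set T}) : R := (q ^+ d X - 1)^-1.

(** A common multiple of the exponents.  Bringing the weights to the denominator
    [q ^+ D - 1] multiplies them by geometric sums, whereas a product of the
    individual denominators would bring in factors with negative coefficients. *)
Let D := (\prod_(X : {set T} | X \proper setT) d X)%N.

(** The rational functions with denominator [(q ^+ D - 1) ^+ k] and a numerator
    with non-negative integer coefficients. *)
Definition nonneg_num (k : nat) (f : R -> R) :=
  exists2 N : {poly int}, nonneg_coefs N &
    forall q, 1 < q -> f q * (q ^+ D - 1) ^+ k = (map_poly intr N).[q].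

Lemma nonneg_num_sum k (I : finType) (P : pred I) (F : I -> R -> R) :
  (forall i, P i -> nonneg_num k (F i)) ->
  nonneg_num k (fun q => \sum_(i | P i) F i q).
Proof.
move=> FP; have FN i : exists N : {poly int}, P i -> nonneg_coefs N /\
    forall q, 1 < q -> F i q * (q ^+ D - 1) ^+ k = (map_poly intr N).[q].
  by have [/FP[N h1 h2]|_] := boolP (P i); [exists N | exists 0].
have [N hN] := choice FN.
exists (\sum_(i | P i) N i); first by apply: nonneg_coefs_sum => i /hN[].
move=> q q1; rewrite big_distrl rmorph_sum horner_sum /=.
by apply: eq_bigr => i /hN[_ ->].
Qed.

Lemma nonneg_numM k l f g : nonneg_num k f -> nonneg_num l g ->
  nonneg_num (k + l) (fun q => f q * g q).
Proof.
move=> [N N0 hN] [M M0 hM]; exists (N * M); first exact: nonneg_coefsM.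
by move=> q q1; rewrite rmorphM hornerM /= -hN // -hM // exprD mulrACA.
Qed.

Lemma dvdn_common (X : {set T}) : X \proper setT -> (d X %| D)%N.
Proof. by move=> XT; rewrite /D (bigD1 X) //= dvdn_mulr. Qed.

(** The quotient of [q ^+ D - 1] by [q ^+ d X - 1] is a geometric sum, and adding
    [1] to the weight multiplies it by [q ^+ d X]. *)
Lemma nonneg_num_weight (X : {set T}) : X \proper setT ->
  nonneg_num 1 (geom_weight^~ X) /\ nonneg_num 1 (fun q => geom_weight q X + 1).
Proof.
move=> XT; have d0 := d_gt0 XT; have /dvdnP[m Dm] := dvdn_common XT.
pose P : {poly int} := \sum_(i < m) 'X^(d X) ^+ i.
have P0 : nonneg_coefs P.
  by apply: nonneg_coefs_sum => i _; rewrite -exprM; apply: nonneg_coefsXn.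
have dq q : 1 < q -> q ^+ d X - 1 != 0 :> R.
  by move=> q1; rewrite gt_eqF // subr_gt0 exprn_egt1 // -lt0n.
have PE q : 1 < q -> geom_weight q X * (q ^+ D - 1) ^+ 1 = (map_poly intr P).[q].
  move=> q1; rewrite expr1 Dm mulnC exprM subrX1 /geom_weight mulKf ?dq //.
  rewrite rmorph_sum horner_sum /=; apply: eq_bigr => i _.
  by rewrite !rmorphXn /= map_polyX !hornerE.
split; first by exists P.
exists ('X^(d X) * P); first by apply: nonneg_coefsM => //; apply: nonneg_coefsXn.
move=> q q1; rewrite rmorphM hornerM -PE // rmorphXn /= map_polyX !hornerE.
rewrite /=; congr (_ * _); rewrite /geom_weight.
by apply: (mulIf (dq q q1)); rewrite mulrDl mulVf ?dq // mul1r mulfVK ?dq // addrC subrK.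
Qed.

Context (h : R -> {set T} -> R).
Context (hrec : forall q, 1 < q -> chain_recursion (geom_weight q) (h q)).

(** Each removal of an element in [top_sum_rec] costs one denominator. *)
Lemma nonneg_num_top n (E : {set T}) a : #|E| = n.+1 -> a \in E ->
  nonneg_num n (fun q => top_sum (geom_weight q) (h q) E a).
Proof.
elim: n E a => [|n IH] E a cE aE.
  exists 1; first exact: (nonneg_coefsXn 0).
  move=> q q1; rewrite (top_sum_rec (hrec q1)) // ifT ?rmorph1 ?mulr1 ?hornerE //.
  by rewrite -cards_eq0; move: cE; rewrite (cardsD1 a) aE add1n => -[->].
have cE' : #|E :\ a| = n.+1 by move: cE; rewrite (cardsD1 a) aE add1n => -[].
have Ea : (E :\ a) \proper setT.
  by rewrite properE subsetT; apply/subsetPn; exists a; rewrite !inE ?eqxx.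
have [w0 w1] := nonneg_num_weight Ea.
suff [N N0 hN] : nonneg_num (1 + n) (fun q => \sum_(b in (E :\ a)%SET)
   (geom_weight q (E :\ a)%SET + (enum_rank b < enum_rank a)%N%:R)
    * top_sum (geom_weight q) (h q) (E :\ a)%SET b).
  exists N => // q q1; rewrite -hN // (top_sum_rec (hrec q1)) // ifN //.
  by rewrite -cards_eq0 cE'.
apply: nonneg_num_sum => b bE; apply: nonneg_numM; last exact: IH.
case: ltnP => _ //=; case: w0 => N N0 hN; exists N => // q q1.
by rewrite addr0 hN.
Qed.

Lemma nonneg_numerator : exists N M : {poly int},
  [/\ forall i, 0 <= N`_i, M != 0 &
      forall q : R, 1 < q ->
        h q setT = (map_poly intr N).[q] / (map_poly intr M).[q]].
Proof.
case: (posnP #|T|) => [T0|Tgt0].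
  (* Without elements there is only the empty chain. *)
  exists 1, 1; split; [|by rewrite oner_eq0|].
    exact: (nonneg_coefsXn 0).
  move=> q q1; rewrite rmorph1 hornerC divr1 hrec // big_pred0 ?addr0 // => X.
  apply/negbTE; rewrite negb_and negbK -cards_eq0 -leqn0 -T0.
  by rewrite max_card.
have [N N0 hN] : nonneg_num #|T|.-1 (fun q => h q setT).
  have [N N0 hN] : nonneg_num #|T|.-1 (fun q => \sum_(a in [set: T]%SET)
      top_sum (geom_weight q) (h q) setT a).
    apply: nonneg_num_sum => a aT; apply: nonneg_num_top => //.
    by rewrite cardsT prednK.
  have T0 : [set: T]%SET != set0 by rewrite -card_gt0 cardsT.
  by exists N => // q q1; rewrite (sum_top_sums (hrec q1)) // hN.
have D0 : (0 < D)%N by rewrite /D prodn_cond_gt0.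
exists N, (('X^D - 1) ^+ #|T|.-1); split.
- exact: N0.
- by rewrite expf_neq0 // monic_neq0 // monicXnsubC.
- move=> q q1; rewrite -hN // rmorphXn /= rmorphB rmorphXn /= map_polyX rmorph1.
  rewrite !hornerE mulfK // expf_neq0 // gt_eqF // subr_gt0 exprn_egt1 //.
  by rewrite -lt0n.
Qed.

End NonnegativeNumerator.

(** * Multichains and their asymptotics *)

(** The partial sums [s] satisfy [s n.+1 = x 0 + c * s n + series y n]; they are
    non-decreasing and bounded, and the limit is the fixed point of the limiting
    affine map. *)
Lemma cvg_series_affine (R : realType) (c : R) (x y : R^nat) (Y : R) :
  0 <= c < 1 -> (forall n, 0 <= x n) -> (forall n, 0 <= y n) ->
  (forall n, x n.+1 = c * x n + y n) ->
  series y @ \oo --> Y -> series x @ \oo --> (x 0%N + Y) / (1 - c).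
Proof.
move=> /andP[c0 c1] x0 y0 xS yY.
have sS n : series x n.+1 = x 0%N + c * series x n + series y n.
  rewrite /series /= big_nat_recl // -addrA big_distrr /= -big_split /=.
  by congr (_ + _); apply: eq_bigr => i _; rewrite xS.
have xnd : nondecreasing_seq (series x).
  by apply/nondecreasing_seqP => n; rewrite /series /= big_nat_recr //= lerDl.
have ynd : nondecreasing_seq (series y).
  by apply/nondecreasing_seqP => n; rewrite /series /= big_nat_recr //= lerDl.
have yle n : series y n <= Y.
  by rewrite -(cvg_lim _ yY) //; apply: nondecreasing_cvgn_le => //; apply/cvg_ex; exists Y.
have xub n : series x n <= (x 0%N + Y) / (1 - c).
  rewrite ler_pdivlMr ?subr_gt0 // mulrBr mulr1 lerBlDr.
  apply: (le_trans (xnd _ _ (leqnSn n))); rewrite sS mulrC.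
  have := yle n; lra.
have /cvg_ex[l xl] : cvgn (series x).
  by apply: nondecreasing_is_cvgn => //; exists ((x 0%N + Y) / (1 - c)) => _ [n _ <-].
suff -> : (x 0%N + Y) / (1 - c) = l by [].
have h1 : (fun n => series x n.+1) @ \oo --> l by rewrite (cvg_shiftS (series x)).
have h2 : (fun n => series x n.+1) @ \oo --> x 0%N + c * l + Y.
  under eq_fun do rewrite sS.
  by apply: cvgD => //; apply: cvgD; [exact: cvg_cst|apply: cvgMr].
have e : x 0%N + c * l + Y = l by rewrite -(cvg_lim _ h2) // (cvg_lim _ h1).
have c10 : 1 - c != 0 by rewrite gt_eqF // subr_gt0.
by apply: (mulIf c10); rewrite mulfVK // mulrBr mulr1 -{1}e; ring.
Qed.

Section MultichainLimit.
Context (R : realType) (T : finType) (u : {set T} -> R).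
Context (uT : u setT = 1).
Context (u_lt1 : forall E : {set T}, E \proper setT -> 0 <= u E < 1).

(** The total weight of the sequences [E >= X_1 >= ... >= X_n] of subsets. *)
Fixpoint multichain_sum (n : nat) (E : {set T}) : R :=
  if n is n'.+1 then \sum_(X : {set T} | X \subset E) u X * multichain_sum n' X
  else 1.
Local Notation Z := multichain_sum.

Lemma weight_ge0 E : 0 <= u E.
Proof.
have [->|ET] := eqVneq E setT; first by rewrite uT.
by have /u_lt1/andP[] : E \proper setT by rewrite properT.
Qed.

Lemma multichain_ge0 n E : 0 <= Z n E.
Proof.
by elim: n E => //= n IH E; rewrite sumr_ge0 // => X _; rewrite mulr_ge0 ?weight_ge0.
Qed.

Lemma multichainS n E : Z n.+1 E
  = u E * Z n E + \sum_(X : {set T} | X \proper E) u X * Z n X.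
Proof.
rewrite /= (bigD1 E) //=; congr (_ + _); apply: eq_bigl => X.
by rewrite properEneq andbC.
Qed.

Context (h : {set T} -> R).
Context (hrec : chain_recursion (fun X => u X / (1 - u X)) h).

(** The chain sum in which the empty set is allowed as a member.  As it can be
    added to any chain, it multiplies the chain sum of a non-empty [E] by
    [1 + u set0 / (1 - u set0)]. *)
Let hbot (E : {set T}) := if E == set0 then 1 else h E / (1 - u set0).

Lemma hbot_rec (E : {set T}) : (0 < #|T|)%N ->
  1 + \sum_(X : {set T} | X \proper E) u X * (hbot X / (1 - u X)) = hbot E.
Proof.
move=> Tgt0; rewrite /hbot; have [->|E0] := eqVneq.
  by rewrite big_pred0 ?addr0 // => X; rewrite properE sub0set andbF.
have u0 : 1 - u set0 != 0.
  have /u_lt1/andP[_] : set0 \proper [set: T]%SET by rewrite proper0 -card_gt0 cardsT.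
  by rewrite -subr_gt0 => /lt0r_neq0.
rewrite (bigD1 set0) ?proper0 //= eqxx div1r addrA.
rewrite [X in X + _](_ : _ = (1 - u set0)^-1); last by field.
rewrite hrec mulrDl mul1r big_distrl /=; congr (_ + _).
rewrite (eq_bigl (fun X => (X != set0) && (X \proper E))); last by move=> X; rewrite andbC.
by apply: eq_bigr => X /andP[/negbTE -> _]; move: (1 - u X)^-1 (1 - u set0)^-1 => a b; ring.
Qed.

Lemma cvg_series_proper (P : pred {set T}) :
  (forall X, P X -> (fun n => series (Z^~ X) n) @ \oo --> hbot X / (1 - u X)) ->
  series (fun n => \sum_(X | P X) u X * Z n X) @ \oo
    --> \sum_(X | P X) u X * (hbot X / (1 - u X)).
Proof.
move=> hP.
rewrite (_ : series _ = fun n => \sum_(X | P X) u X * series (Z^~ X) n); last first.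
  apply/funext => n; rewrite /series /= exchange_big /=; apply: eq_bigr => X _.
  by rewrite big_distrr.
apply: cvg_big => [|X PX]; first exact: add_continuous.
by apply: cvgMr; exact: hP.
Qed.

(** A multichain is a chain of subsets strictly contained in [E] with positive
    multiplicities, which contribute [u / (1 - u)] for each member, together with
    some number of copies of [E], which contribute [1 / (1 - u E)]. *)
Lemma cvg_series_multichain (E : {set T}) : E \proper setT ->
  series (Z^~ E) @ \oo --> hbot E / (1 - u E).
Proof.
have [n] := ubnP #|E|; elim: n E => // n IH E cE ET.
have Tgt0 : (0 < #|T|)%N by rewrite -cardsT (leq_ltn_trans _ (proper_card ET)).
rewrite -hbot_rec //.
apply: (@cvg_series_affine _ (u E) (Z^~ E)
  (fun n => \sum_(X : {set T} | X \proper E) u X * Z n X)).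
- exact: u_lt1.
- by move=> k; apply: multichain_ge0.
- by move=> k; apply: sumr_ge0 => X _; rewrite mulr_ge0 ?weight_ge0 ?multichain_ge0.
- by move=> k; apply: multichainS.
apply: (cvg_series_proper (P := fun X : {set T} => X \proper E)) => // X XE.
apply: IH; last exact: proper_trans XE ET.
by apply: leq_trans (proper_card XE) _.
Qed.

Lemma cvg_multichain_proper (E : {set T}) : E \proper setT -> Z^~ E @ \oo --> 0.
Proof.
move=> /cvg_series_multichain hE; apply: cvg_series_cvg_0.
by apply/cvg_ex; eexists; exact: hE.
Qed.

(** As the full set has weight [1], a step from [n] to [n.+1] only adds the
    multichains of length [n.+1] of proper subsets; so the sequence is a sequence
    of partial sums of the convergent series above. *)
Lemma cvg_multichain_setT : (0 < #|T|)%N ->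
  Z^~ setT @ \oo --> h setT / (1 - u set0).
Proof.
move=> Tgt0; have := hbot_rec setT Tgt0; rewrite {2}/hbot ifN;
  last by rewrite -card_gt0 cardsT.
move=> <-.
rewrite (_ : Z^~ setT = fun n => 1 + series (fun n =>
  \sum_(X : {set T} | X \proper setT) u X * Z n X) n).
  apply: cvgD; first exact: cvg_cst.
  by apply: (cvg_series_proper (P := fun X : {set T} => X \proper setT)) =>
    // X /cvg_series_multichain.
apply/funext; elim => [|n IH]; first by rewrite /series /= big_geq // addr0.
by rewrite multichainS uT mul1r {1}IH /series /= big_nat_recr //= addrA.
Qed.

End MultichainLimit.

Section Levels.
Context (T : finType).

(** The sets E_k above, when [f a] is the length of the scalar at the arrow [a]. *)
Definition level n (f : {ffun T -> 'I_n}) (k : nat) : {set T} :=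
  [set a | (k < f a)%N]%SET.

Context (R : realType) (u : {set T} -> R).

(** Lower all positive values of [f] by one: the levels move down by one step and
    the lowest level [X] becomes a bound for the new ones. *)
Lemma sum_levels_rec n (X : {set T}) :
  \sum_(f : {ffun T -> 'I_n.+2} | level f 0 == X) \prod_(k < n.+1) u (level f k)
  = u X * \sum_(f : {ffun T -> 'I_n.+1} | level f 0 \subset X)
      \prod_(k < n) u (level f k).
Proof.
rewrite big_distrr /=.
pose up (f : {ffun T -> 'I_n.+1}) : {ffun T -> 'I_n.+2} :=
  [ffun a => if a \in X then inord (f a).+1 else ord0].
pose down (f : {ffun T -> 'I_n.+2}) : {ffun T -> 'I_n.+1} :=
  [ffun a => inord (f a).-1].
have upE f a : up f a = (if a \in X then (f a).+1 else 0%N) :> nat.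
  by rewrite ffunE; case: ifP => // _; rewrite inordK // ltnS.
have downE f a : down f a = (f a).-1 :> nat.
  rewrite ffunE inordK //; have := ltn_ord (f a); case: (nat_of_ord (f a)) => //=.
rewrite (reindex_onto up down) /=; last first.
  move=> f /eqP/setP fX; apply/ffunP => a; apply: val_inj; rewrite /= upE downE.
  have := fX a; rewrite inE; case: (a \in X); first by move=> /prednK.
  by move=> /negbT; rewrite -eqn0Ngt => /eqP ->.
have levelS f k : level (up f) k.+1 = (level f k :&: X)%SET.
  by apply/setP => a; rewrite !inE upE; case: (a \in X); rewrite ?andbT ?andbF ?ltnS.
have level0 f : level (up f) 0 = X.
  by apply/setP => a; rewrite !inE upE; case: (a \in X).
apply: eq_big => [f|f /andP[_ /eqP fE]].
  rewrite level0 eqxx /=; apply/eqP/subsetP => [<- a|fX].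
    by rewrite !inE downE upE; case: (a \in X).
  apply/ffunP => a; apply: val_inj; rewrite /= downE upE.
  have [//|aX] := boolP (a \in X).
  have : a \notin level f 0 by apply: contra aX; exact: fX.
  by rewrite inE -eqn0Ngt => /eqP ->.
rewrite big_ord_recl /= level0; congr (_ * _); apply: eq_bigr => k _.
congr u; rewrite /bump /= add1n levelS; apply/setIidPl/subsetP => a.
by rewrite inE -fE downE upE; case: (a \in X).
Qed.

(** A bounded function is the same as the decreasing sequence of its levels. *)
Lemma sum_levels n (E : {set T}) :
  \sum_(f : {ffun T -> 'I_n.+1} | level f 0 \subset E) \prod_(k < n) u (level f k)
  = multichain_sum u n E.
Proof.
elim: n E => [|n IH] E.
  rewrite (big_pred1 [ffun=> ord0]) ?big_ord0 // => f.
  have -> : f = [ffun=> ord0] by apply/ffunP => a; rewrite ffunE ord1.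
  by rewrite /= eqxx; apply/subsetP => a; rewrite inE ffunE.
rewrite (partition_big (fun f => level f 0) (fun X : {set T} => X \subset E)) //=.
apply: eq_bigr => X XE; rewrite -IH -sum_levels_rec; apply: eq_bigl => f.
by case: eqP => [->|_]; rewrite ?XE ?andbF.
Qed.

End Levels.

(** * The fine Hilbert series of a Stanley-Reisner ring *)

Section Monomials.
Context (K : choiceType) (F : nzRingType).

Lemma mcoeff_monom (x : F) (m k : K) :
  mcoeff k << x *g m >> = if m == k then x else 0.
Proof. by rewrite mcoeffU; case: (m == k); rewrite ?mulr1n ?mulr0n. Qed.

Lemma scale_monom (c x : F) (m : K) :
  c *: (<< x *g m >> : {malg F[K]}) = << c * x *g m >>.
Proof.
by apply/malgP => k; rewrite mcoeffZ !mcoeff_monom; case: (m == k); rewrite ?mulr0.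
Qed.

End Monomials.

(** Dimension counts in a graded piece, which is a line, reduce to scalars by this
    formula and the next lemma. *)
Lemma sum_line (F : nzRingType) (M : lmodType F) n (b : 'I_n -> M)
    (beta c : 'I_n -> F) (e : M) :
  (forall i, b i = beta i *: e) ->
  \sum_i c i *: b i = (\sum_i c i * beta i) *: e.
Proof.
by move=> be; rewrite scaler_suml; apply: eq_bigr => i _; rewrite be scalerA.
Qed.

Lemma dependent_scalars (F : fieldType) n (beta : 'I_n.+2 -> F) :
  exists2 c : 'I_n.+2 -> F, \sum_i c i * beta i = 0 & exists i, c i != 0.
Proof.
pose i1 : 'I_n.+2 := lift ord0 ord0.
pose c x y (i : 'I_n.+2) := if i == ord0 then x else if i == i1 then y else 0 : F.
have cE x y : \sum_i c x y i * beta i = x * beta ord0 + y * beta i1.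
  rewrite (bigD1 ord0) //= (bigD1 i1) //= big1 ?addr0 // => i.
  by move=> /andP[/negbTE i0 /negbTE ii]; rewrite /c i0 ii mul0r.
have [b0|b0] := eqVneq (beta ord0) 0.
  exists (c 1 0); first by rewrite cE b0 mulr0 mul0r addr0.
  by exists ord0; rewrite /c oner_eq0.
exists (c (beta i1) (- beta ord0)); first by rewrite cE mulNr mulrC subrr.
by exists i1; rewrite /c oppr_eq0.
Qed.

Section StanleyReisnerDim.
Context (V : finType) (Delta : {set {set V}}).
Context (Delta_down : forall C C' : {set V},
  C \subset C' -> C' \in Delta -> C \in Delta).

Definition supp (m : {cmonom V}) : {set V} := [set v | m v != 0%N]%SET.

Definition indicator (C : {set V}) : {cmonom V} :=
  \big[mmul/mone]_(v in C) ucm v.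

Lemma indicatorE C v : indicator C v = (v \in C) :> nat.
Proof.
rewrite /indicator (big_morph (fun m : {cmonom V} => m v) (cmM v) (cm1 v)).
have [vC|vC] := boolP (v \in C).
  rewrite (bigD1 v) //= cmU eqxx big1 // => w /andP[_ /negbTE wv].
  by rewrite cmU wv.
rewrite big1 // => w wC; rewrite cmU; case: eqVneq => // wv.
by rewrite -wv wC in vC.
Qed.

Lemma monomM (a : rat) (k l : {cmonom V}) :
  << a *g k >> * << l >> = << a *g mmul k l >> :> polyring V.
Proof. by rewrite malgM_def fgmulUU mulr1. Qed.

Lemma squarefree_monomialE C : squarefree_monomial C = << indicator C >>.
Proof.
symmetry; rewrite /squarefree_monomial /indicator.
apply: (big_morph (fun m : {cmonom V} => << m >> : polyring V)) => //.
by move=> k l; rewrite monomM.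
Qed.

(** The ideal is spanned by the multiples of squarefree monomials of non-faces, and
    a multiple of such a monomial has a non-face in its support. *)
Lemma mcoeff_SR_ideal p m : SR_ideal Delta p -> supp m \in Delta -> p@_m = 0.
Proof.
move=> [c ->] mD; rewrite raddf_sum big1 //= => C CD.
rewrite squarefree_monomialE malgM_def fgmulgU raddf_sum big1_seq //= => k _.
rewrite mcoeffU; case: eqVneq => //= km; case/negP: CD.
apply: (Delta_down _ mD); apply/fintype.subsetP => v vC.
by rewrite inE -km cmM indicatorE vC addn1.
Qed.

(** The monomial is divisible by the squarefree monomial of its support. *)
Lemma SR_ideal_monom (a : rat) m : supp m \notin Delta ->
  SR_ideal Delta << a *g m >>.
Proof.
move=> mD.
exists (fun C => if C == supp m then << a *g divcm m (indicator C) >> else 0).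
rewrite (bigD1 (supp m)) //= eqxx big1 ?addr0; last first.
  by move=> C /andP[_ /negbTE ->]; rewrite mul0r.
rewrite squarefree_monomialE.
rewrite monomM.
have -> : mmul (divcm m (indicator (supp m))) (indicator (supp m)) = m; last by [].
apply/eqP/cmP => v; rewrite cmM divcmE indicatorE inE.
by case: (m v) => // n; rewrite subn1 addn1.
Qed.

Lemma SR_ideal0 : SR_ideal Delta 0.
Proof. by exists (fun=> 0); rewrite big1 // => C _; rewrite mul0r. Qed.

Lemma has_dim_mod_out m n : supp m \notin Delta ->
  has_dim_mod (SR_ideal Delta) (homogeneous_piece m) n -> n = 0%N.
Proof.
move=> mD [b [bW bfree _]]; case: n b bW bfree => // n b bW bfree.
have hb i : b i = mcoeff m (b i) *: << (1 : rat) *g m >>.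
  rewrite scale_monom mulr1; have [x ->] := bW i.
  by rewrite mcoeff_monom eqxx.
suff /bfree/(_ ord0)/eqP : SR_ideal Delta (\sum_i (1 : rat) *: b i) by rewrite oner_eq0.
by rewrite (sum_line _ hb) scale_monom; apply: SR_ideal_monom.
Qed.

Lemma has_dim_mod_in m n : supp m \in Delta ->
  has_dim_mod (SR_ideal Delta) (homogeneous_piece m) n -> n = 1%N.
Proof.
move=> mD [b [bW bfree bgen]].
case: n b bW bfree bgen => [|[|n]] b bW bfree bgen //.
  have [|c] := bgen << (1 : rat) *g m >>; first by exists 1.
  rewrite big_ord0 subr0 => /mcoeff_SR_ideal/(_ mD)/eqP.
  by rewrite mcoeff_monom eqxx oner_eq0.
(* A linearly dependent family contradicts freeness. *)
pose beta i := mcoeff m (b i).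
have hb i : b i = beta i *: << (1 : rat) *g m >>.
  rewrite scale_monom mulr1 /beta; have [x ->] := bW i.
  by rewrite mcoeff_monom eqxx.
have [c c0 [i /eqP[]]] := dependent_scalars beta.
apply: bfree; rewrite (sum_line _ hb) c0 scale0r; exact: SR_ideal0.
Qed.

Lemma SR_dimE m : SR_dim Delta m = (supp m \in Delta).
Proof.
rewrite /SR_dim; case: xgetP => [n _ /=|].
  have [mD|mD] := boolP (supp m \in Delta); first exact: has_dim_mod_in.
  exact: has_dim_mod_out.
have [mD /(_ 1%N)[]|//] := boolP (supp m \in Delta).
exists (fun=> << (1 : rat) *g m >>); split=> [_|c|_ [a ->]]; first by exists 1.
  rewrite big_ord1 => /mcoeff_SR_ideal/(_ mD).
  by rewrite scale_monom mulr1 mcoeff_monom eqxx => c0 i; rewrite (ord1 i).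
exists (fun=> a); rewrite big_ord1 (_ : _ - _ = 0); first exact: SR_ideal0.
by rewrite scale_monom mulr1 subrr.
Qed.

End StanleyReisnerDim.

Section BoxSums.
Context (R : realType) (V : finType) (Delta : {set {set V}}) (u : V -> R).
Context (Delta_down : forall C C' : {set V},
  C \subset C' -> C' \in Delta -> C \in Delta).
Context (u01 : forall v, 0 <= u v < 1).

Let term (m : {cmonom V}) : R := (SR_dim Delta m)%:R * \prod_(v : V) u v ^+ m v.

Let u0 v : 0 <= u v. Proof. by case/andP: (u01 v). Qed.

Let term_ge0 m : 0 <= term m.
Proof. by rewrite mulr_ge0 // prodr_ge0 // => v _; rewrite exprn_ge0. Qed.

Definition monom_of n (f : {ffun V -> 'I_n}) : {cmonom V} :=
  [cmonom (f v : nat) | v in [fset v | v : V]%fset]%M.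

Lemma monom_ofE n (f : {ffun V -> 'I_n}) v : monom_of f v = f v :> nat.
Proof. by rewrite cmE fsfun_fun ifT //; apply/imfsetP; exists v. Qed.

Definition box n : set {cmonom V} := [set m : {cmonom V} | forall v, (m v < n)%N].

Lemma monom_of_bij n : set_bij [set: {ffun V -> 'I_n}] (box n) (@monom_of n).
Proof.
split=> [f _ v|f g _ _ fg|m hm] /=.
- by rewrite monom_ofE.
- by apply/ffunP => v; apply: val_inj; rewrite /= -!monom_ofE fg.
- exists [ffun v => Ordinal (hm v)] => //; apply/eqP/cmP => v.
  by rewrite monom_ofE ffunE.
Qed.

Lemma finite_box n : finite_set (box n).
Proof.
have [sub _ surj] := monom_of_bij n.
apply: sub_finite_set surj _; apply: finite_image; exact: finite_finset.
Qed.

(** The sum of the series over the exponent vectors with entries below [n],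
    arranged by the support [C] of the exponent vector: an index in [C] runs over
    the exponents [k > 0] and an index outside [C] has exponent [0]. *)
Definition box_sum n : R :=
  \sum_(C in Delta) \prod_v \sum_(k < n)
    if v \in C then (k != 0 :> nat)%:R * u v ^+ k else (k == 0 :> nat)%:R.

(** Distribute the product over the sums; an exponent vector is met with non-zero
    coefficient only for [C] equal to its support. *)
Lemma fsum_box n : (\sum_(m \in box n) (term m)%:E)%E = (box_sum n)%:E.
Proof.
rewrite (reindex_fsbig (@monom_of n) [set: {ffun V -> 'I_n}] (box n) _ (monom_of_bij n)).
transitivity (\sum_(f : {ffun V -> 'I_n}) (term (monom_of f))%:E)%E.
  rewrite [RHS]fsbig_seq ?index_enum_uniq //; apply: eq_fsbigl.
  by apply/seteqP; split=> // f _ /=; rewrite mem_index_enum.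
rewrite sumEFin /box_sum; congr _%:E.
under [RHS]eq_bigr do rewrite bigA_distr_bigA /=.
rewrite exchange_big /=; apply: eq_bigr => f _.
rewrite /term SR_dimE //.
pose s := supp (monom_of f).
have sE v : (v \in s) = (f v != 0%N :> nat) by rewrite inE monom_ofE.
have out C : C != s -> \prod_v (if v \in C then (f v != 0%N :> nat)%:R * u v ^+ f v
    else (f v == 0%N :> nat)%:R) = 0 :> R.
  move=> Cs; have [v hv] : exists v, (v \in C) != (v \in s).
    apply/existsP; apply: contraNT Cs; rewrite negb_exists => /forallP h.
    by apply/eqP/setP => v; apply/eqP; have := h v; rewrite negbK.
  apply/eqP/prodf_eq0; exists v => //; move: hv; rewrite sE.
  by case: (v \in C); case: (f v == 0%N :> nat) => //= _; rewrite mul0r.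
have ins : \prod_v (if v \in s then (f v != 0%N :> nat)%:R * u v ^+ f v
    else (f v == 0%N :> nat)%:R) = \prod_v u v ^+ monom_of f v.
  apply: eq_bigr => v _; rewrite sE monom_ofE.
  by case: eqP => [->|_] /=; rewrite ?expr0 ?mul1r.
have [sD|sD] := boolP (s \in Delta).
  by rewrite [RHS](bigD1 s) //= [X in _ = _ + X]big1 ?addr0 ?ins ?mul1r // =>
    C /andP[_ /out].
rewrite mul0r [RHS]big1 // => C CD; apply: out.
by apply: contraNneq sD => <-.
Qed.

Lemma cvg_box_sum : box_sum @ \oo --> \sum_(C in Delta) \prod_(v in C) (u v / (1 - u v)).
Proof.
rewrite -(cvg_shiftS box_sum) /=.
apply: cvg_big => [|C CD]; first exact: add_continuous.
rewrite [X in _ --> X]big_mkcond /=.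
apply: cvg_big => [|v _]; first exact: mul_continuous.
case: ifP => vC.
  rewrite (_ : (fun _ => _) = series (geometric (u v) (u v))); last first.
    apply/funext => n; rewrite /series /= big_ord_recl /= mul0r add0r big_mkord.
    by apply: eq_bigr => k _; rewrite /geometric /= mul1r exprS.
  by apply: cvg_geometric_series; rewrite ger0_norm //; case/andP: (u01 v).
rewrite (_ : (fun _ => _) = fun=> 1); first exact: cvg_cst.
by apply/funext => n; rewrite big_ord_recl /= big1 ?addr0.
Qed.

(** The boxes exhaust the exponent vectors and the terms are non-negative, so the
    series is the limit of the box sums. *)
Lemma fine_HilbE :
  fine_Hilb Delta u = (\sum_(C in Delta) \prod_(v in C) (u v / (1 - u v)))%:E.
Proof.
set L := \sum_(C in Delta) _.
have cL : box_sum @ \oo --> L := cvg_box_sum.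
have nd : nondecreasing_seq box_sum.
  apply/nondecreasing_seqP => n; apply: ler_sum => C _; apply: ler_prod => v _.
  rewrite big_ord_recr /=; apply/andP; split; last first.
    by rewrite lerDl; case: ifP => _; rewrite ?mulr_ge0 ?exprn_ge0.
  by apply: sumr_ge0 => k _; case: ifP => _; rewrite ?mulr_ge0 ?exprn_ge0.
have leL n : box_sum n <= L.
  rewrite -(cvg_lim _ cL) //; apply: nondecreasing_cvgn_le => //.
  by apply/cvg_ex; exists L; exact: cL.
rewrite /fine_Hilb; apply/eqP; rewrite eq_le; apply/andP; split.
  apply: ge_ereal_sup => _ [X [finX _] <-].
  pose n := (\max_(m <- fset_set X) \max_v m v)%N.+1.
  apply: (@le_trans _ _ (\sum_(m \in box n) (term m)%:E)%E); last first.
    by rewrite fsum_box lee_fin.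
  apply: lee_fsum_nneg_subset => //; first exact: finite_box.
    move=> m mX; apply: mem_set => v; rewrite ltnS.
    apply: (@leq_trans (\max_w m w)%N); first exact: (leq_bigmax v).
    by apply: leq_bigmax_seq => //; rewrite in_fset_set.
  move=> m _; rewrite lee_fin; exact: term_ge0.
have boxE n : ((box_sum n)%:E <= esum [set: {cmonom V}] (fun m => (term m)%:E))%E.
  rewrite -fsum_box; apply: esum_ge; exists (box n) => //.
  by split=> //; exact: finite_box.
have /cvg_lim <- // : (box_sum n)%:E @[n --> \oo] --> L%:E.
  by apply: cvg_EFin; [exact: nearW|exact: cL].
apply: lime_le; last exact: nearW.
apply/cvg_ex; exists L%:E; apply: cvg_EFin; [exact: nearW|exact: cL].
Qed.
End BoxSums.

(** * Components and Betti numbers of subquivers *)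

Section Betti.
Context (Q : quiver).
Implicit Types E : {set arr Q}.

Definition comps E := ncomponents (subquiver E).

Definition const_along (A : finType) E : {set {ffun vert Q -> A}} :=
  [set h : {ffun vert Q -> A} | [forall a in E, h (src a) == h (tgt a)]]%SET.

(** A function constant along the arrows of [E] is determined by its values at one
    root of each component, and these are arbitrary.  All facts about components
    used below follow from this count. *)
Lemma card_const_along (A : finType) E :
  #|const_along A E| = (#|A| ^ comps E)%N.
Proof.
set e := @Defs.adjacent (subquiver E).
have esym : symmetric e.
  by move=> i j; rewrite /e /Defs.adjacent; apply: eq_existsb => a; rewrite orbC.
have csym : connect_sym e by apply: sym_connect_sym.
pose rt := {i : vert Q | fingraph.roots e i}.
pose ext (k : {ffun rt -> A}) : {ffun vert Q -> A} :=
  [ffun i => k (Sub (fingraph.root e i) (roots_root csym i))].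
have ext_inj : injective ext.
  move=> k k' /ffunP kk'; apply/ffunP => i.
  have := kk' (val i); rewrite !ffunE.
  suff -> : Sub (fingraph.root e (val i)) (roots_root csym (val i)) = i by [].
  by apply: val_inj; rewrite /=; apply/eqP; exact: (valP i).
have -> : const_along A E
    = [set ext k | k : {ffun rt -> A}]%SET.
  apply/setP => h; rewrite inE; apply/forall_inP/imsetP.
    move=> hE; exists [ffun i => h (val i)] => //.
    apply/ffunP => i; rewrite !ffunE /=.
    have : connect e i (fingraph.root e i) by apply: connect_root.
    move=> /connectP[p + ->]; elim: p i => [|j p IH] i //=.
    move=> /andP[/existsP[a ha] pth]; rewrite -(IH j pth).
    have := hE _ (valP a).
    by case/orP: ha => /andP[/= /eqP <- /eqP <-] /eqP.
  move=> [k _ ->] a aE; rewrite !ffunE; apply/eqP; congr (k _); apply: val_inj => /=.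
  apply/eqP; rewrite root_connect //; apply/connect1/existsP; exists (Sub a aE).
  by rewrite /= !eqxx.
rewrite card_imset // card_ffun; congr (_ ^ _)%N.
rewrite card_sig /ncomponents /n_comp_mem; apply: eq_card => i.
by rewrite !inE andbT.
Qed.

Lemma bettiE E : betti (subquiver E) = (comps E)%:Z - #|vert Q|%:Z + #|E|%:Z.
Proof. by rewrite /betti /= card_sig; congr (_ + _%:Z); apply: eq_card. Qed.

Lemma comps0 : comps set0 = #|vert Q|.
Proof.
have := card_const_along bool set0; rewrite card_bool => /esym/eqP.
rewrite (_ : const_along _ _ = setT) ?cardsT ?card_ffun ?card_bool ?eqn_exp2l //.
  by move=> /eqP.
by apply/setP => h; rewrite !inE; apply/forall_inP => a; rewrite inE.
Qed.

Lemma compsT : comps [set: arr Q] = ncomponents Q.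
Proof.
rewrite /comps /ncomponents; apply: eq_n_comp => i j; apply: eq_connect => {i j} i j.
rewrite /Defs.adjacent; apply/existsP/existsP => -[a ha]; first by exists (val a).
by exists (Sub a (in_setT a)).
Qed.

Lemma bettiT : betti (subquiver [set: arr Q]) = betti Q.
Proof. by rewrite bettiE compsT /betti cardsT. Qed.

Lemma betti0 : betti (subquiver (set0 : {set arr Q})) = 0.
Proof. by rewrite bettiE comps0 cards0 subrr. Qed.

Lemma const_alongS (A : finType) (E E' : {set arr Q}) :
  E \subset E' -> const_along A E' \subset const_along A E.
Proof.
move=> /subsetP EE'; apply/subsetP => h; rewrite !inE => /forall_inP hE.
by apply/forall_inP => a /EE'/hE.
Qed.

Lemma comps_subset (E E' : {set arr Q}) : E \subset E' -> (comps E' <= comps E)%N.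
Proof.
move=> /(const_alongS bool)/subset_leq_card.
by rewrite !card_const_along card_bool leq_exp2l.
Qed.

(** Compare the functions to [bool] that are constant along [E] and along
    [a |: E].  Over F_2 the jump across [a] is a linear form on the first space
    whose kernel is the second, so the dimensions differ by at most one. *)
Lemma comps_setU1 a E : (comps E <= (comps (a |: E)).+1)%N.
Proof.
rewrite -(@leq_exp2l 2) // expnS -card_bool -!card_const_along.
(* If some function [h1] jumps across [a], adding it to another one that jumps
   removes the jump. *)
pose jump (h : {ffun vert Q -> bool}) := h (src a) (+) h (tgt a).
have [h1 /andP[h1E h1a]|nojump] := pickP (fun h =>
  (h \in const_along bool E) && jump h); last first.
  apply: (@leq_trans #|const_along bool (a |: E)|);
    last by rewrite card_bool mul2n -addnn leq_addr.
  apply/subset_leq_card/subsetP => h hE; rewrite inE; apply/forall_inP => b.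
  rewrite !inE => /orP[/eqP->|bE]; last by move: hE; rewrite inE => /forall_inP ->.
  by have := nojump h; rewrite hE /= => /negbT; rewrite negb_add.
pose shift (h : {ffun vert Q -> bool}) : {ffun vert Q -> bool} := [ffun i => h i (+) h1 i].
have shift_inj : injective shift.
  move=> h h' /ffunP hh'; apply/ffunP => i; have := hh' i; rewrite !ffunE.
  by move=> /addIb.
have sub : const_along bool E \subset const_along bool (a |: E)
    :|: shift @: const_along bool (a |: E).
  apply/subsetP => h hE; rewrite in_setU; case: (boolP (jump h)) => jh.
    apply/orP; right; apply/imsetP; exists (shift h).
      rewrite inE; apply/forall_inP => b; rewrite !inE !ffunE => /orP[/eqP->|bE].
        move: jh h1a; rewrite /jump;
        by case: (h _) (h _) (h1 _) (h1 _) => [] [] [] [].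
      move: hE h1E; rewrite !inE => /forall_inP/(_ b bE)/eqP -> /forall_inP/(_ b bE)/eqP ->.
      by rewrite eqxx.
    by apply/ffunP => i; rewrite !ffunE -addbA addbb addbF.
  apply/orP; left; rewrite inE; apply/forall_inP => b; rewrite !inE => /orP[/eqP->|bE].
    by move: jh; rewrite /jump negb_add.
  by move: hE; rewrite inE => /forall_inP ->.
apply: leq_trans (subset_leq_card sub) _; apply: leq_trans (leq_card_setU _ _) _.
by rewrite card_imset // card_bool mul2n addnn.
Qed.

(** A new arrow raises the number of arrows by one and lowers the number of
    components by at most one. *)
Lemma betti_subset (E E' : {set arr Q}) :
  E \subset E' -> betti (subquiver E) <= betti (subquiver E').
Proof.
move=> EE'; have [n] := ubnP #|E' :\: E|; elim: n E EE' => // n IH E EE' hn.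
have [E0|[a]] := set_0Vmem (E' :\: E).
  suff -> : E = E' by [].
  by apply/eqP; rewrite eqEsubset EE' -setD_eq0 E0 eqxx.
rewrite inE => /andP[aE aE'].
have le1 : betti (subquiver E) <= betti (subquiver (a |: E)).
  rewrite !bettiE cardsU1 aE; have := comps_setU1 a E; lia.
apply: le_trans le1 (IH _ _ _); first by rewrite subUset sub1set aE'.
rewrite setUC -setDDl; rewrite ltnS in hn; apply: leq_trans hn.
by rewrite [X in (_ <= X)%N](cardsD1 a) inE aE aE'.
Qed.

Context (hQ : two_connected Q).

(** Removing one arrow of a 2-connected quiver keeps it connected, so it lowers the
    Betti number by exactly one; removing more arrows does not raise it. *)
Lemma betti_proper E : E \proper setT -> betti (subquiver E) < betti Q.
Proof.
move=> /properP[_ [a _ aE]].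
have : betti (subquiver E) <= betti (subquiver [set~ a]).
  by apply: betti_subset; rewrite subsetC sub1set inE.
case: hQ => cQ /(_ a) ca; rewrite [X in _ <= X]bettiE /comps ca => /le_lt_trans; apply.
rewrite /betti cQ cardsC1; have : (0 < #|arr Q|)%N by apply/card_gt0P; exists a.
lia.
Qed.

End Betti.

(** * Truncated polynomials *)

Section TruncatedPolynomials.
Context (K : fieldType) (n : nat).
Notation S := (trunc K n.+1).
Implicit Types x y : S.

Lemma size_modulus : size (mk_monic ('X^(n.+1) : {poly K})) = n.+2.
Proof. by rewrite mk_monic_Xn size_polyXn. Qed.

Lemma trunc_coef_big x i : (n < i)%N -> (x : {poly K})`_i = 0.
Proof. by move=> ni; apply: big_coef_npoly; rewrite size_modulus. Qed.

Lemma truncP x y :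
  (forall i, (i <= n)%N -> (x : {poly K})`_i = (y : {poly K})`_i) -> x = y.
Proof.
move=> xy; apply/val_inj/polyP => i; have [/xy//|ni] := leqP i n.
by rewrite !trunc_coef_big.
Qed.

Lemma coef_in_trunc (p : {poly K}) i : (i <= n)%N ->
  (in_qpoly 'X^(n.+1) p : {poly K})`_i = p`_i.
Proof.
move=> ni; rewrite /in_qpoly /= mk_monic_Xn /=.
rewrite -[p in LHS](poly_take_drop n.+1) addrC.
rewrite Pdiv.RingMonic.rmodp_addl_mul_small ?monicXn //.
  by rewrite coef_take_poly ltnS ni.
by rewrite size_polyXn ltnS size_take_poly.
Qed.

Lemma coef_truncM x y i : (i <= n)%N ->
  ((x * y : S) : {poly K})`_i = \sum_(j < i.+1) (x : {poly K})`_j * (y : {poly K})`_(i - j).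
Proof. by move=> ni; rewrite -coefM; exact: coef_in_trunc. Qed.

Lemma coef_truncD x y i :
  ((x + y : S) : {poly K})`_i = (x : {poly K})`_i + (y : {poly K})`_i.
Proof. by rewrite -coefD. Qed.

Lemma coef_trunc1 i : ((1 : S) : {poly K})`_i = (i == 0%N)%:R.
Proof. by rewrite coefC; case: eqP. Qed.

(** The ring is local, with maximal ideal generated by t. *)
Lemma trunc_unitE x : (x \is a GRing.unit) = ((x : {poly K})`_0 != 0).
Proof.
apply/idP/idP => [/divrr/(congr1 (fun z : S => (z : {poly K})`_0))|x0].
  rewrite coef_truncM // coef_trunc1 big_ord1 /= => e.
  by apply/eqP => x0; move/eqP: e; rewrite x0 mul0r eq_sym oner_eq0.
have cop : coprimep (mk_monic 'X^(n.+1)) (x : {poly K}).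
  move: (x : {poly K}) x0 => p p0; rewrite mk_monic_Xn /= coprimep_pexpl // coprimep_sym.
  by rewrite -['X]subr0 -polyC0 coprimep_XsubC /root horner_coef0.
by apply/unitrP; exists (qpoly_inv x); split; [apply: qpoly_mulVz | apply: qpoly_mulzV].
Qed.

Definition mk_trunc (E : nat -> K) : S := in_qpoly 'X^(n.+1) (\poly_(i < n.+1) E i).

Lemma coef_mk_trunc E i : (i <= n)%N -> (mk_trunc E : {poly K})`_i = E i.
Proof. by move=> ni; rewrite coef_in_trunc // coef_poly ltnS ni. Qed.

(** With v the order of vanishing of [x] at t = 0, this is [n.+1 - v], the length of
    the ideal generated by [x]; it is [0] for [x = 0]. *)
Definition colength x : nat :=
  (n.+1 - find (fun i => (x : {poly K})`_i != 0)%R (iota 0 n.+1))%N.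

Lemma colength_le x : (colength x <= n.+1)%N.
Proof. exact: leq_subr. Qed.

Lemma colength_eq x k : (k <= n.+1)%N ->
  (colength x == k) = [forall i : 'I_n.+1, if (i < n.+1 - k)%N then (x : {poly K})`_i == 0
     else if i == (n.+1 - k)%N :> nat then (x : {poly K})`_i != 0 else true].
Proof.
move=> kn; rewrite /colength; set P := fun i => _; set s := iota _ _.
have sz : size s = n.+1 by rewrite size_iota.
have fle : (find P s <= n.+1)%N by rewrite -sz find_size.
have sn i : (i < n.+1)%N -> nth 0%N s i = i by move=> ?; rewrite nth_iota.
rewrite -(eqn_add2r (find P s)) subnK // -{1}(subnK kn) [(k + _)%N]addnC eqn_add2r eq_sym.
apply/eqP/forallP => [fE i|h].
  case: ltnP => [ik|ki].
    have := before_find 0%N (_ : (i < find P s)%N); rewrite fE sn // => /(_ ik).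
    by move=> /negbT; rewrite negbK.
  case: eqP => // ik; have hs : has P s by rewrite has_find fE sz -ik.
  by have := nth_find 0%N hs; rewrite fE -ik sn.
have [k0|kgt0] := posnP k.
  rewrite k0 subn0 -sz; apply: hasNfind; apply/hasPn => i; rewrite mem_iota add0n =>
    /andP[_ iN].
  have := h (Ordinal iN); rewrite k0 subn0 /= iN /P => /eqP ->.
  by rewrite eqxx.
have kN : (n.+1 - k < n.+1)%N by rewrite ltn_subrL kgt0.
apply/eqP; rewrite eqn_leq; apply/andP; split.
  rewrite leqNgt; apply/negP => /(before_find 0%N); rewrite sn //.
  by have := h (Ordinal kN); rewrite /= ltnn eqxx /P => ->.
rewrite leqNgt; apply/negP => flt.
have fN : (find P s < n.+1)%N by apply: ltn_trans kN.
have hs : has P s by rewrite has_find sz.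
have := nth_find 0%N hs; rewrite sn // /P.
by have := h (Ordinal fN); rewrite /= flt => /eqP ->; rewrite eqxx.
Qed.

Lemma colength_eq0 x : (colength x == 0%N) = (x == 0).
Proof.
rewrite colength_eq // subn0; apply/forallP/eqP => [h|-> i].
  apply: truncP => i ni; have := h (Ordinal (ni : (i < n.+1)%N)); rewrite /= ltnS ni =>
    /eqP ->.
  by rewrite coef0.
by rewrite ltn_ord coef0.
Qed.

(** The annihilator of [x] is the ideal generated by t^(colength of x): compare
    coefficients, starting from the first non-zero coefficient of [x]. *)
Lemma trunc_mul_eq0 x y : (x * y == 0) =
  [forall k : 'I_n.+1, (k < colength x)%N ==> ((y : {poly K})`_k == 0)].
Proof.
have := eqxx (colength x); rewrite (colength_eq x (colength_le x)).
set l := colength x => /forallP hx.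
have lN : (l <= n.+1)%N by apply: colength_le.
have xlow i : (i < n.+1 - l)%N -> (x : {poly K})`_i = 0.
  move=> il; have iN : (i < n.+1)%N by apply: leq_trans il (leq_subr _ _).
  by have := hx (Ordinal iN); rewrite /= il => /eqP.
apply/eqP/forall_inP => [xy|hy].
  move=> [k kN] /= kl; move: kN => _; have [m] := ubnP k; elim: m k kl => // m IH k kl km.
  have vN : (n.+1 - l < n.+1)%N by rewrite ltn_subrL (leq_ltn_trans _ kl).
  have xv : (x : {poly K})`_(n.+1 - l) != 0 by have := hx (Ordinal vN);
    rewrite /= ltnn eqxx.
  have kvN : (n.+1 - l + k <= n)%N by rewrite -ltnS -[X in (_ < X)%N](subnK lN) ltn_add2l.
  have := congr1 (fun z : S => (z : {poly K})`_(n.+1 - l + k)) xy.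
  rewrite coef_truncM // coef0.
  have vk : (n.+1 - l < (n.+1 - l + k).+1)%N by rewrite ltnS leq_addr.
  rewrite (bigD1 (Ordinal vk)) //= big1 ?addr0; last first.
    move=> [i iN] /= /negbTE; rewrite -val_eqE /= => iv.
    have [ilt|ige] := ltnP i (n.+1 - l); first by rewrite xlow // mul0r.
    have ilt : (n.+1 - l < i)%N by rewrite ltn_neqAle eq_sym iv.
    have ik : (n.+1 - l + k - i < k)%N by rewrite ltn_subLR // ltn_add2r.
    rewrite [X in _ * X](eqP (IH _ _ _)) ?mulr0 //; first exact: ltn_trans kl.
    by apply: leq_trans ik _.
  by rewrite addKn => /eqP; rewrite mulf_eq0 (negbTE xv).
apply: truncP => i ni; rewrite coef_truncM // coef0 big1 // => -[j jN] _ /=.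
have [jl|jl] := ltnP j (n.+1 - l); first by rewrite xlow // mul0r.
have ijN : (i - j < n.+1)%N by apply: leq_ltn_trans (leq_subr _ _) _.
rewrite (eqP (hy (Ordinal ijN) _)) ?mulr0 //=.
rewrite ltn_subLR //; apply: leq_trans (_ : n.+1 - l + l <= _)%N; first by rewrite subnK.
by rewrite leq_add2r.
Qed.

End TruncatedPolynomials.

(** * Counting gauge transformations *)

Lemma card_ffun_forall (I T : finType) (P : I -> pred T) :
  #|[set f : {ffun I -> T} | [forall i, P i (f i)]]%SET| = (\prod_i #|P i|)%N.
Proof.
transitivity #|family P|; first by apply: eq_card => f; rewrite inE.
by rewrite card_family foldrE big_map big_enum.
Qed.

Lemma card_ffun_unit (T : finType) (P : pred T) :
  #|[pred f : {ffun unit -> T} | P (f tt)]| = #|P|.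
Proof.
have := card_ffun_forall (fun _ : unit => P); rewrite (big_pred1 tt); last by case.
by move=> <-; apply: eq_card => f; rewrite !inE; apply/idP/forallP => [? []|].
Qed.

Lemma card_nonzero (F : finFieldType) : #|[pred x : F | x != 0]| = #|F|.-1.
Proof. by rewrite (cardC1 (0 : F)). Qed.

Lemma card_const_nonzero (Q : quiver) (E : {set arr Q}) (F : finFieldType) :
  #|[set h in const_along F E | [forall i, h i != 0]]%SET| = (#|F|.-1 ^ comps E)%N.
Proof.
(* Apply the count to functions with values in the non-zero scalars. *)
pose F' : finType := {x : F | x != 0}.
have <- : #|F'| = #|F|.-1 by rewrite card_sig card_nonzero.
rewrite -(card_const_along F' E).
pose ext (h : {ffun vert Q -> F'}) : {ffun vert Q -> F} := [ffun i => val (h i)].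
have ext_inj : injective ext.
  move=> h h' /ffunP hh; apply/ffunP => i; apply: val_inj.
  by have := hh i; rewrite !ffunE.
rewrite -(card_imset _ ext_inj); apply: eq_card => h; rewrite !inE.
apply/andP/imsetP => [[/forall_inP hE /forallP h0]|[h']].
  exists [ffun i => Sub (h i) (h0 i)]; last by apply/ffunP => i; rewrite !ffunE.
  by rewrite inE; apply/forall_inP => a /hE; rewrite !ffunE -val_eqE.
rewrite inE => /forall_inP hE ->; split; last first.
  by apply/forallP => i; rewrite ffunE (valP (h' i)).
by apply/forall_inP => a /hE; rewrite !ffunE -val_eqE.
Qed.

Section CountTruncated.
Context (F : finFieldType) (n : nat).
Notation S := (trunc F n.+1).

(** A family of truncated polynomials is a family of coefficient vectors, so
    conditions that bear on each coefficient separately can be counted separately.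
    The formula is used for elements of given length and for stabilizers. *)
Lemma card_coefs (I : finType) (P : 'I_n.+1 -> pred {ffun I -> F}) :
  #|[set g : {ffun I -> S} |
      [forall k, P k [ffun i => (g i : {poly F})`_(k : 'I_n.+1)]]]%SET|
  = (\prod_k #|P k|)%N.
Proof.
rewrite -card_ffun_forall.
pose coefs (g : {ffun I -> S}) : {ffun 'I_n.+1 -> {ffun I -> F}} :=
  [ffun k : 'I_n.+1 => [ffun i => (g i : {poly F})`_k]].
have coefs_inj : injective coefs.
  move=> g g' /ffunP gg; apply/ffunP => i; apply: truncP => k kn.
  by have /ffunP/(_ i) := gg (Ordinal (kn : (k < n.+1)%N)); rewrite !ffunE.
rewrite -(card_imset _ coefs_inj); apply: eq_card => G; rewrite !inE.
apply/imsetP/forallP => [[g gP ->] k|hG].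
  by move: gP; rewrite inE => /forallP/(_ k); rewrite ffunE.
pose g : {ffun I -> S} := [ffun i => mk_trunc n (fun k => G (inord k) i)].
have gE : coefs g = G.
  apply/ffunP => k; apply/ffunP => i; rewrite !ffunE coef_mk_trunc ?inord_val //.
  by rewrite -ltnS.
exists g => //; rewrite inE; apply/forallP => k.
by have := hG k; rewrite -gE ffunE.
Qed.

Lemma card_colength k : (k <= n.+1)%N ->
  #|[pred x : S | colength x == k]| = (if k is k'.+1 then #|F|.-1 * #|F| ^ k' else 1)%N.
Proof.
case: k => [_|k kn].
  by rewrite (eq_card (B := pred1 0)) ?card1 // => x; rewrite !inE colength_eq0.
(* Length [k.+1] means: zero below coefficient [n - k], non-zero there. *)
pose Q j : pred F := fun c => if (j < n.+1 - k.+1)%N then c == 0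
  else if j == (n.+1 - k.+1)%N then c != 0 else true.
pose P (j : 'I_n.+1) := [pred h : {ffun unit -> F} | Q j (h tt)].
transitivity (\prod_(j < n.+1) #|Q j|)%N.
  rewrite -card_ffun_unit.
  under [RHS]eq_bigr do rewrite -card_ffun_unit.
  rewrite -[RHS](card_coefs P); apply: eq_card => g; rewrite !inE colength_eq //.
  by apply: eq_forallb => j; rewrite !inE ffunE.
have kn' : (k <= n)%N by [].
rewrite subSS in @Q P *; rewrite -(big_mkord xpredT (fun j => #|Q j|)).
rewrite (@big_cat_nat _ _ _ (n - k)) ?leq0n ?(leq_trans (leq_subr _ _)) //=.
rewrite big_nat_cond big1 ?mul1n; last first.
  move=> j /andP[/andP[_ jk] _]; rewrite (eq_card (B := pred1 0)) ?card1 // => c.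
  by rewrite !inE unfold_in /Q jk.
rewrite big_ltn ?ltnS ?leq_subr //; congr (_ * _)%N.
  rewrite -card_nonzero; apply: eq_card => c; rewrite !inE unfold_in /Q.
  by rewrite ltnn eqxx.
rewrite big_nat_cond (eq_bigr (fun=> #|F|)); last first.
  move=> j /andP[/andP[jk _] _]; apply: eq_card => c; rewrite !inE unfold_in /Q.
  by rewrite ltnNge (ltnW jk) /= gtn_eqF.
by rewrite -big_nat_cond prod_nat_const_nat subSS subKn.
Qed.

Lemma card_units (I : finType) :
  #|[set g : {ffun I -> S} | [forall i, g i \is a GRing.unit]]%SET|
  = ((#|F|.-1 * #|F| ^ n) ^ #|I|)%N.
Proof.
rewrite (card_ffun_forall (fun _ : I => [pred x : S | x \is a GRing.unit])).
rewrite (eq_bigr (fun=> (#|F|.-1 * #|F| ^ n)%N)).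
  by rewrite prod_nat_const.
move=> _ _; rewrite -(@card_colength n.+1) //; apply: eq_card => x.
rewrite !inE colength_eq // subnn trunc_unitE.
apply/idP/forallP => [x0 i|/(_ ord0)//].
by case: eqP => // ->.
Qed.

(** Coefficient [k] of a stabilizing family is constant along the arrows of [E k],
    independently for each [k]; being a unit concerns the constant coefficient
    only. *)
Lemma card_stabilizer (Q : quiver) (x : arr Q -> S) :
  let E k := [set a | k < colength (x a)]%SET%N in
  #|[set g : {ffun vert Q -> S} | [forall i, g i \is a GRing.unit] &&
     [forall a, x a * (g (src a) - g (tgt a)) == 0]]%SET|
  = (#|F|.-1 ^ comps (E 0%N) * \prod_(k < n) #|F| ^ comps (E k.+1))%N.
Proof.
move=> E; rewrite -card_const_nonzero.
pose P (k : 'I_n.+1) := [pred h : {ffun vert Q -> F} | (h \in const_along F (E k)) &&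
   ((k == 0 :> nat) ==> [forall i, h i != 0])].
transitivity (\prod_k #|P k|)%N.
  rewrite -card_coefs; apply: eq_card => g; rewrite !inE.
  apply/andP/forallP => [[/forallP gu /forallP gE] k|h].
    rewrite inE; apply/andP; split.
      rewrite inE; apply/forall_inP => a; rewrite inE => ak; rewrite !ffunE.
      have := gE a; rewrite trunc_mul_eq0 => /forall_inP/(_ k ak).
      by rewrite coefB subr_eq0.
    apply/implyP => /eqP k0; apply/forallP => i.
    by have := gu i; rewrite trunc_unitE ffunE k0.
  split; apply/forallP; [move=> i | move=> a].
    by have := h ord0; rewrite inE /= => /andP[_ /forallP/(_ i)]; rewrite ffunE trunc_unitE.
  rewrite trunc_mul_eq0; apply/forall_inP => k ka.
  have := h k; rewrite inE => /andP[]; rewrite inE => /forall_inP/(_ a).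
  by rewrite inE => /(_ ka); rewrite !ffunE coefB subr_eq0.
rewrite big_ord_recl; congr (_ * _)%N.
  by apply: eq_card => h; rewrite !inE /=.
by apply: eq_bigr => k _; rewrite -card_const_along; apply: eq_card => h;
  rewrite !inE andbT.
Qed.

End CountTruncated.

(** * Isomorphism classes of representations of rank one *)

(** Each class [C] contributes #C summands 1/#C. *)
Lemma card_classes (R : numFieldType) (T : finType) (cls : T -> {set T}) (X : {set T}) :
  (forall x, x \in cls x) ->
  (forall x y, y \in cls x -> cls y = cls x) ->
  (forall x y, x \in X -> y \in cls x -> y \in X) ->
  #|cls @: X|%:R = \sum_(x in X) #|cls x|%:R^-1 :> R.
Proof.
move=> refl same closed.
rewrite (partition_big_imset cls) /= -sum1_card natr_sum.
apply: eq_bigr => C /imsetP[x xX ->].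
rewrite (eq_bigr (fun=> #|cls x|%:R^-1)); last by move=> y /andP[_ /eqP ->].
rewrite (eq_bigl [in cls x]) => [|y]; last first.
  apply/andP/idP => [[_ /eqP <-] //|yx].
  by rewrite (same _ _ yx) (closed _ _ xX yx).
rewrite sumr_const -[RHS]mulr_natr mulVf // pnatr_eq0 -lt0n card_gt0.
by apply/set0Pn; exists x.
Qed.

Lemma gauge_mul_fix (A : comUnitRingType) (m hs ht gs gt : A) :
  hs \is a GRing.unit -> gs \is a GRing.unit -> m * (hs - ht) = 0 ->
  m * (ht * gt) / (hs * gs) = m * gt / gs.
Proof.
move=> hu gu; rewrite mulrBr => /subr0_eq e.
apply: (mulIr (_ : hs * gs \is a GRing.unit)); rewrite ?unitrM ?hu //.
rewrite divrK ?unitrM ?hu // [hs * gs in RHS]mulrC mulrA [RHS]mulrA divrK //.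
by rewrite -e mulrAC.
Qed.

Lemma gauge_div_fix (A : comUnitRingType) (m gs gt ks kt : A) :
  gs \is a GRing.unit -> kt \is a GRing.unit ->
  m * gt / gs = m * kt / ks -> m * (gs / ks - gt / kt) = 0.
Proof.
move=> gu ku e; have e' : m * gt = m * kt / ks * gs by rewrite -e divrK.
rewrite mulrBr [m * (gt / kt)]mulrA e'; apply/eqP; rewrite subr_eq0; apply/eqP.
apply: (mulIr ku); rewrite divrK // -!mulrA; congr (_ * _).
by rewrite mulrCA [RHS]mulrCA [gs * _]mulrC.
Qed.

Lemma gauge_transfer (A : comUnitRingType) (m p l gs gt hs ht : A) :
  gs \is a GRing.unit -> gt \is a GRing.unit ->
  m * gt = gs * p -> m * ht = hs * l -> p * (ht / gt) = hs / gs * l.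
Proof.
move=> gsu gtu e1 e2; apply: (mulrI gsu).
rewrite [LHS]mulrA -e1 -[LHS]mulrA [gt * (_ / _)]mulrCA divrr // mulr1 e2.
by rewrite [RHS]mulrA [gs * (_ / _)]mulrCA divrr // mulr1.
Qed.

Section Entries.
Context (Q : quiver) (K : fieldType) (n : nat).
Notation S := (trunc K n.+1).
Implicit Types M : rep (fun _ : vert Q => 1%N) S.

Definition entry M (a : arr Q) : S := (M a : 'M[S]_1) ord0 ord0.

Definition support M : {set arr Q} := [set a | entry M a != 0]%SET.

End Entries.
Arguments entry {Q K n} M a.
Arguments support {Q K n} M.

Section Orbits.
Context (Q : quiver) (F : finFieldType) (n : nat).
Notation S := (trunc F n.+1).
Notation rk1 := (fun _ : vert Q => 1%N).
Notation rank1 := (rep rk1 S).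

Definition of_entries (x : {ffun arr Q -> S}) : rank1 :=
  [ffun a : arr Q => (const_mx (x a) : 'M[S]_(rk1 (src a), rk1 (tgt a)))].

Lemma of_entriesE x a : entry (of_entries x) a = x a.
Proof. by rewrite /entry /of_entries ffunE mxE. Qed.

Lemma entry_inj (M N : rank1) : entry M =1 entry N -> M = N.
Proof.
move=> MN; apply/ffunP => a; apply/matrixP => i j.
by have := MN a; rewrite /entry (ord1 i) (ord1 j).
Qed.

Lemma rep_iso_entry (M N : rank1) : rep_iso M N <->
  exists g : {ffun vert Q -> S}, (forall i, g i \is a GRing.unit) /\
    forall a, entry M a * g (tgt a) = g (src a) * entry N a.
Proof.
split=> [[g [gu gE]]|[g [gu gE]]].
  exists [ffun i => (g i : 'M[S]_1) ord0 ord0]; split=> [i|a].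
    by rewrite ffunE; have := gu i; rewrite unitmxE (det_mx11 (g i)).
  have /matrixP/(_ ord0 ord0) := gE a.
  by rewrite !ffunE /entry !mxE !big_ord1.
exists (fun i => (g i)%:M : 'M[S]_1); split=> [i|a].
  by rewrite unitmxE det_mx11 mxE eqxx mulr1n.
apply/matrixP => i j; rewrite (ord1 i) (ord1 j) !mxE !big_ord1 !mxE !eqxx !mulr1n.
exact: gE.
Qed.

Definition gauge : {set {ffun vert Q -> S}} :=
  [set g : {ffun vert Q -> S} | [forall i, g i \is a GRing.unit]]%SET.

Definition stab (M : rank1) : {set {ffun vert Q -> S}} :=
  [set g : {ffun vert Q -> S} | [forall i, g i \is a GRing.unit] &&
     [forall a, entry M a * (g (src a) - g (tgt a)) == 0]]%SET.

Definition iso_class (M : rank1) : {set rank1} :=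
  [set N : rank1 | `[< rep_iso M N >]]%SET.

Definition act (M : rank1) (g : {ffun vert Q -> S}) : rank1 :=
  of_entries [ffun a => entry M a * g (tgt a) / g (src a)].

Lemma iso_classE M : iso_class M = act M @: gauge.
Proof.
apply/setP => N; rewrite inE; apply/asboolP/imsetP.
  move=> /rep_iso_entry[g [gu gE]]; exists g; first by rewrite inE; apply/forallP.
  apply: entry_inj => a; rewrite of_entriesE ffunE gE.
  by rewrite mulrC mulKr.
move=> [g]; rewrite inE => /forallP gu ->; apply/rep_iso_entry; exists g; split=> // a.
by rewrite of_entriesE ffunE mulrC [RHS]mulrC divrK // mulrC.
Qed.

(** All fibres of [act M] on the gauge group are translates of the stabilizer. *)
Lemma orbit_stabilizer M : (#|iso_class M| * #|stab M| = #|gauge|)%N.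
Proof.
rewrite iso_classE -[RHS]sum1_card (partition_big_imset (act M)) /=.
rewrite -sum_nat_const; apply: eq_bigr => N /imsetP[g0]; rewrite inE => /forallP g0u ->.
pose shift (h : {ffun vert Q -> S}) : {ffun vert Q -> S} := [ffun i => h i * g0 i].
have shift_inj : injective shift.
  move=> h h' /ffunP hh; apply/ffunP => i; have := hh i; rewrite !ffunE.
  by move/(mulIr (g0u i)).
rewrite sum1_card -(card_imset _ shift_inj); apply: eq_card => g; rewrite unfold_in /=.
apply/imsetP/andP => [[h]|].
  rewrite inE => /andP[/forallP hu /forallP hE] ->; split.
    by rewrite inE; apply/forallP => i; rewrite ffunE unitrM hu g0u.
  apply/eqP/entry_inj => a; rewrite !of_entriesE !ffunE.
  by apply: gauge_mul_fix => //; apply/eqP.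
rewrite inE => -[/forallP gu /eqP gE].
exists [ffun i => g i / g0 i]; last by apply/ffunP => i; rewrite !ffunE divrK.
rewrite inE; apply/andP; split; apply/forallP; [move=> i | move=> a].
  by rewrite ffunE unitrM gu unitrV g0u.
have := congr1 (entry^~ a) gE; rewrite !of_entriesE !ffunE => e.
by apply/eqP; apply: gauge_div_fix.
Qed.

Lemma support_iso (M N : rank1) : N \in iso_class M -> support N = support M.
Proof.
rewrite iso_classE => /imsetP[g]; rewrite inE => /forallP gu ->.
apply/setP => a; rewrite !inE of_entriesE ffunE.
congr (~~ _); apply/eqP/eqP => [e|->]; last by rewrite !mul0r.
apply: (mulIr (gu (tgt a))); rewrite mul0r.
by apply: (mulIr (_ : (g (src a))^-1 \is a GRing.unit)); rewrite ?unitrV // e mul0r.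
Qed.

Lemma iso_class_refl (M : rank1) : M \in iso_class M.
Proof.
rewrite inE; apply/asboolP/rep_iso_entry; exists [ffun=> 1]; split=> [i|a].
  by rewrite ffunE unitr1.
by rewrite !ffunE mulr1 mul1r.
Qed.

Lemma iso_class_same (M N : rank1) : N \in iso_class M -> iso_class N = iso_class M.
Proof.
rewrite inE => /asboolP/rep_iso_entry[g [gu gE]].
apply/setP => L; rewrite !inE; apply/asboolP/asboolP => /rep_iso_entry[h [hu hE]];
  apply/rep_iso_entry.
  exists [ffun i => g i * h i]; split=> [i|a]; first by rewrite ffunE unitrM gu hu.
  by rewrite !ffunE mulrA gE -mulrA hE mulrA.
exists [ffun i => h i / g i]; split=> [i|a]; first by rewrite ffunE unitrM unitrV gu hu.
by rewrite !ffunE; apply: gauge_transfer (gE a) (hE a).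
Qed.

(** By [orbit_stabilizer], 1/#C is the order of a stabilizer divided by that of the
    gauge group, so that no orbit has to be described. *)
Lemma card_iso_classes (R : numFieldType) (X : {set rank1}) (conn : pred {set arr Q}) :
  (forall M, (M \in X) = conn (support M)) ->
  #|[set iso_class M | M in X]%SET|%:R
  = \sum_(x : {ffun arr Q -> S} | conn [set a | x a != 0]%SET)
      #|stab (of_entries x)|%:R / #|gauge|%:R :> R.
Proof.
move=> XE; rewrite card_classes; first last.
- by move=> M N; rewrite !XE => MX /support_iso ->.
- exact: iso_class_same.
- exact: iso_class_refl.
rewrite (reindex of_entries) /=; last first.
  exists (fun M => [ffun a => entry M a]) => [x _|M _].
    by apply/ffunP => a; rewrite ffunE of_entriesE.
  by apply: entry_inj => a; rewrite of_entriesE ffunE.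
apply: eq_big => [x|x _].
  by rewrite XE; congr conn; apply/setP => a; rewrite !inE of_entriesE.
have c0 : (0 < #|iso_class (of_entries x)|)%N.
  by rewrite card_gt0; apply/set0Pn; eexists; exact: iso_class_refl.
have s0 : (0 < #|stab (of_entries x)|)%N.
  rewrite card_gt0; apply/set0Pn; exists [ffun=> 1]; rewrite inE; apply/andP; split.
    by apply/forallP => i; rewrite ffunE unitr1.
  by apply/forallP => a; rewrite !ffunE subrr mulr0.
rewrite -(orbit_stabilizer (of_entries x)) natrM invfM mulrCA divff ?mulr1 //.
by rewrite pnatr_eq0 -lt0n.
Qed.

End Orbits.

(** * Indecomposable representations of rank one *)

(** Connectedness is expressed by functions to [bool], because these are what a
    decomposition into two summands provides. *)
Lemma comps1P (Q : quiver) (E : {set arr Q}) (i0 : vert Q) :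
  reflect (forall h, h \in const_along bool E -> forall i j, h i = h j) (comps E == 1%N).
Proof.
have cb (b : bool) : [ffun=> b] \in const_along bool E.
  by rewrite inE; apply/forall_inP => a _; rewrite !ffunE.
have tf : [ffun=> true] != [ffun=> false] :> {ffun vert Q -> bool}.
  by apply/eqP => /ffunP/(_ i0); rewrite !ffunE.
have sub : [set [ffun=> true]; [ffun=> false]]%SET \subset const_along bool E.
  by rewrite subUset !sub1set !cb.
have cE := card_const_along bool E; rewrite card_bool in cE.
apply: (iffP eqP) => [c1 h hE i j|hE].
  have : [set [ffun=> true]; [ffun=> false]]%SET == const_along bool E.
    by rewrite eqEcard sub cE c1 cards2 tf.
  by move=> /eqP e; move: hE; rewrite -e !inE => /orP[] /eqP ->; rewrite !ffunE.
have : [set [ffun=> true]; [ffun=> false]]%SET == const_along bool E.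
  rewrite eqEsubset sub; apply/subsetP => h /hE hc; rewrite !inE.
  case hi: (h i0); [apply/orP; left | apply/orP; right];
    by apply/eqP/ffunP => j; rewrite ffunE -hi; apply: hc.
move=> /eqP e; move: cE; rewrite -e cards2 tf => /eqP.
by rewrite -[X in X == _]/(2 ^ 1)%N eqn_exp2l // => /eqP.
Qed.

Section RankOne.
Context (Q : quiver) (K : fieldType) (n : nat).
Notation S := (trunc K n.+1).
Notation rk1 := (fun _ : vert Q => 1%N).

Let e : 'rV[S]_1 := const_mx 1.

Lemma rank1_rowE (x : 'rV[S]_1) : x = x ord0 ord0 *: e.
Proof. by apply/matrixP => i j; rewrite !mxE mulr1 (ord1 i) (ord1 j). Qed.

Lemma rank1_full (U : {pred 'rV[S]_1}) (u : 'rV[S]_1) :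
  submod_closed U -> u \in U -> u ord0 ord0 \is a GRing.unit -> forall x, x \in U.
Proof.
move=> [U0 UZ] uU uu x.
have -> : x = (x ord0 ord0 / u ord0 ord0) *: u + 0.
  by rewrite addr0 [X in _ *: X]rank1_rowE scalerA divrK // -rank1_rowE.
exact: UZ.
Qed.

Lemma sum1_unit (x y : S) : x + y = 1 -> (x \is a GRing.unit) || (y \is a GRing.unit).
Proof.
move=> xy; rewrite !trunc_unitE -negb_and; apply/negP => /andP[/eqP x0 /eqP y0].
have := coef_truncD x y 0; rewrite xy coef_trunc1 x0 y0 addr0 => /eqP.
by rewrite oner_eq0.
Qed.

(** In a decomposition of S into two submodules, one of the components of [1] is a
    unit, so one submodule is everything and the other is zero.  A decomposition
    of a representation of rank one is therefore a partition of the vertices that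
    is not crossed by an arrow with non-zero scalar. *)
Lemma indecomposable_rank1 (i0 : vert Q) (M : rep rk1 S) :
  indecomposable M <-> comps (support M) == 1%N.
Proof.
split=> [ind|/(comps1P _ i0) conn].
  apply/negPn/negP => /(comps1P _ i0) nconn; apply: nconn => h hE i j.
  apply/eqP/negPn/negP => hij; apply: ind.
  pose U (b : bool) (k : vert Q) : {pred 'rV[S]_1} :=
    fun x => (h k == b) || (x == 0).
  have inU b k x : (x \in U b k) = (h k == b) || (x == 0) by [].
  have sr b : is_subrep M (U b).
    split=> [k|a x].
      split=> [|a x y]; first by rewrite inU eqxx orbT.
      rewrite !inU; case: (h k == b) => //= /eqP -> /eqP ->.
      by rewrite scaler0 addr0.
    rewrite !inU => /orP[hs|/eqP ->]; last by rewrite mul0mx eqxx orbT.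
    have [aM|aM] := boolP (a \in support M).
      by move: hE; rewrite inE => /forall_inP/(_ a aM)/eqP <-; rewrite hs.
    apply/orP; right; apply/eqP/matrixP => k l; rewrite !mxE big_ord1.
    by move: aM; rewrite inE negbK /entry (ord1 l) => /eqP ->; rewrite mulr0.
  have nz b : (exists k, h k = b) -> nonzero_subrep (U b).
    move=> [k hk]; exists k, e; first by rewrite inU hk eqxx.
    by apply/eqP => /matrixP/(_ ord0 ord0); rewrite !mxE => /eqP; rewrite oner_eq0.
  have both b : exists k, h k = b.
    by move: hij; case: b; case hi: (h i); case hj: (h j) => // _;
      [exists i | exists j | exists j | exists i].
  exists (U true), (U false); split; [by split | exact: nz | exact: nz |].
  move=> k; split=> x.
    case hk: (h k); first by exists x, 0; rewrite !inU hk !eqxx orbT addr0.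
    by exists 0, x; rewrite !inU hk !eqxx orbT add0r.
  by rewrite !inU; case: (h k) => /= [_ /eqP|/eqP].
move=> [U [W [[[Usub Uarr] [Wsub Warr]] [i [x xU x0]] [j [y yW y0]] dir]]].
have dich k : (forall z, z \in U k) /\ (forall z, z \in W k -> z = 0) \/
    (forall z, z \in W k) /\ (forall z, z \in U k -> z = 0).
  have [/(_ e)[u [w [uU wW euw]]] UW] := dir k.
  have /sum1_unit/orP[uu|wu] : u ord0 ord0 + w ord0 ord0 = 1.
  - by have /matrixP/(_ ord0 ord0) := euw; rewrite !mxE.
  - have full := rank1_full (Usub k) uU uu; left; split=> // z; exact: UW.
  - have full := rank1_full (Wsub k) wW wu; right; split=> // z zU; exact: UW.
have e0 : e != 0.
  by apply/eqP => /matrixP/(_ ord0 ord0); rewrite !mxE => /eqP; rewrite oner_eq0.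
pose h : {ffun vert Q -> bool} := [ffun k => e \in U k].
have hT k z : z \in U k -> z != 0 -> h k.
  move=> zU z0; rewrite ffunE; have [[-> //]|[_ UZ]] := dich k.
  by case/eqP: z0; apply: UZ.
have hF k z : z \in W k -> z != 0 -> ~~ h k.
  move=> zW z0; rewrite ffunE; have [[_ WZ]|[_ UZ]] := dich k.
    by case/eqP: z0; apply: WZ.
  by apply/negP => /UZ e0'; rewrite e0' eqxx in e0.
have hE : h \in const_along bool (support M).
  rewrite inE; apply/forall_inP => a; rewrite inE => aM.
  have eM : e *m (M a : 'M[S]_1) != 0.
    apply: contra aM => /eqP/matrixP/(_ ord0 ord0).
    by rewrite !mxE big_ord1 mxE mul1r /entry => ->.
  have [[Ufull _]|[Wfull _]] := dich (src a).
    rewrite (hT _ _ (Ufull e) e0) (hT (tgt a) (e *m M a)) //.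
    by apply: Uarr.
  rewrite (negbTE (hF _ _ (Wfull e) e0)) (negbTE (hF (tgt a) (e *m M a) _ _)) //.
  by apply: Warr.
have := conn h hE i j; rewrite (hT _ _ xU x0) => /esym hj.
by have := hF _ _ yW y0; rewrite hj.
Qed.

End RankOne.

(** Hence base change preserves the support, and absolute indecomposability can be
    read off over the ground field. *)
Lemma trunc_map_eq0 (F K : fieldType) (f : {rmorphism F -> K}) n (x : trunc F n.+1) :
  (trunc_map f x == 0) = (x == 0).
Proof.
apply/eqP/eqP => [fx|->]; last by rewrite /trunc_map rmorph0 raddf0.
apply: truncP => i ni; rewrite coef0; apply/eqP.
rewrite -(fmorph_eq0 f) -coef_map -(coef_in_trunc _ ni); apply/eqP.
have := congr1 (fun z : trunc K n.+1 => (z : {poly K})`_i) fx.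
by rewrite coef0.
Qed.

Lemma support_base_change (Q : quiver) (F K : fieldType) (f : {rmorphism F -> K}) n
    (M : rep (fun _ : vert Q => 1%N) (trunc F n.+1)) :
  support (base_change f M) = support M.
Proof. by apply/setP => a; rewrite !inE /entry ffunE mxE trunc_map_eq0. Qed.

Lemma abs_indecomposable_rank1 (Q : quiver) (F : finFieldType) n (i0 : vert Q)
    (M : rep (fun _ : vert Q => 1%N) (trunc F n.+1)) :
  abs_indecomposable M <-> comps (support M) == 1%N.
Proof.
have := indecomposable_rank1 i0 (base_change (to_alg_closure F) M).
by rewrite support_base_change.
Qed.

(** * The normalized count as a sum over multichains *)

Section Count.
Context (R : realType) (Q : quiver) (F : finFieldType) (n : nat).
Notation S := (trunc F n.+1).
Notation q := (#|F|%:R : R).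
Notation c := (1 - q^-1 : R).

Lemma card_field_gt1 : 1 < q.
Proof. by rewrite ltr1n card_finNzRing_gt1. Qed.

Let q0 : q != 0. Proof. by rewrite gt_eqF // (lt_trans ltr01) // card_field_gt1. Qed.
Let c0 : c != 0.
Proof. by rewrite gt_eqF // subr_gt0 invf_lt1 ?card_field_gt1 // (lt_trans ltr01)
  ?card_field_gt1. Qed.

(** Turns the number of non-zero scalars into the factor [1 - 1/q] of the
    statement. *)
Lemma pred_card_field : (#|F|.-1)%:R = c * q :> R.
Proof.
rewrite -subn1 natrB; last exact: ltnW (card_finNzRing_gt1 F).
by rewrite mulrBl mul1r (mulVf q0).
Qed.

Definition colengths (x : {ffun arr Q -> S}) : {ffun arr Q -> 'I_n.+2} :=
  [ffun a => inord (colength (x a))].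

Lemma colengthsE x a : colengths x a = colength (x a) :> nat.
Proof. by rewrite ffunE inordK // ltnS colength_le. Qed.

Lemma card_colengths (f : {ffun arr Q -> 'I_n.+2}) :
  #|[pred x | colengths x == f]|%:R
  = c ^+ #|level f 0| * \prod_(k < n.+1) q ^+ #|level f k| :> R.
Proof.
pose P a := [pred y : S | colength y == f a].
have -> : #|[pred x | colengths x == f]|
    = #|[set x : {ffun arr Q -> S} | [forall a, P a (x a)]]%SET|.
  apply: eq_card.
  move=> x; rewrite !inE; apply/eqP/forallP => [xf a|h].
    by rewrite /P /= -xf colengthsE.
  by apply/ffunP => a; apply: val_inj; rewrite /= colengthsE; exact/eqP/(h a).
rewrite (card_ffun_forall P) natr_prod.
have -> : c ^+ #|level f 0| = \prod_a (if a \in level f 0 then c else 1).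
  by rewrite -big_mkcond prodr_const.
under [X in _ = _ * X]eq_bigr do rewrite -prodr_const big_mkcond.
rewrite exchange_big -big_split /=; apply: eq_bigr => a _.
rewrite card_colength -1?ltnS //.
rewrite (eq_bigr (fun k : 'I_n.+1 => if (k < f a)%N then q else 1)); last first.
  by move=> k _; rewrite inE.
rewrite -big_mkcond /= prodr_const inE.
have -> : #|[pred k : 'I_n.+1 | (k < f a)%N]| = f a.
  have fa : (f a <= n.+1)%N by rewrite -ltnS.
  by rewrite -[RHS]card_ord -!sum1_card (big_ord_widen n.+1 (fun=> 1%N) fa).
case: (nat_of_ord (f a)) => [|k]; first by rewrite expr0 mulr1.
by rewrite natrM pred_card_field natrX exprS mulrA.
Qed.

Lemma card_gauge :
  #|@gauge Q F n|%:R = c ^+ #|vert Q| * \prod_(k < n.+1) q ^+ #|vert Q| :> R.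
Proof.
rewrite card_units natrX natrM pred_card_field natrX -mulrA -exprS exprMn.
by rewrite prodr_const card_ord exprAC.
Qed.

Lemma card_stab (x : {ffun arr Q -> S}) :
  comps (level (colengths x) 0) = 1%N ->
  #|stab (of_entries x)|%:R
  = c * \prod_(k < n.+1) q ^+ comps (level (colengths x) k) :> R.
Proof.
move=> c1; have := card_stabilizer (entry (of_entries x)).
have lE k : [set a | (k < colength (entry (of_entries x) a))%N]%SET = level (colengths x) k.
  by apply/setP => a; rewrite !inE of_entriesE colengthsE.
rewrite /= -/(stab _) => ->; rewrite lE c1 natrM natr_prod natrX expr1 pred_card_field.
rewrite big_ord_recl /= c1 expr1 mulrA; congr (_ * _).
by apply: eq_bigr => k _; rewrite lE natrX.
Qed.

Definition codim_weight (q : R) (E : {set arr Q}) : R :=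
  q ^ (betti (subquiver E) - betti Q).

(** Sort the representations by the lengths of their scalars.  For given lengths,
    with levels E_k, the representations, their stabilizers and the gauge group
    contribute powers of [1 - 1/q] and, for each [k], the powers of [q] with
    exponents |E_k|, comps (E_k) and - #|vert Q|: together, the Betti number of the
    subquiver on E_k. *)
Lemma normalized_countE (i0 : vert Q) :
  normalized_count R Q F n.+1 =
  \sum_(E : {set arr Q} | comps E == 1%N) c ^ betti (subquiver E)
     * (codim_weight q E * multichain_sum (codim_weight q) n E).
Proof.
rewrite /normalized_count /num_abs_indec.
set X := [set M | `[< abs_indecomposable M >]]%SET.
have XE M : (M \in X) = (comps (support M) == 1%N).
  by rewrite inE; apply/asboolP/idP => /(abs_indecomposable_rank1 i0).
have H := @card_iso_classes Q F n R X (fun E => comps E == 1%N) XE;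
  rewrite /iso_class in H; rewrite H {H} big_distrr /=.
have suppE (x : {ffun arr Q -> S}) : [set a | x a != 0]%SET = level (colengths x) 0.
  by apply/setP => a; rewrite !inE colengthsE lt0n colength_eq0.
rewrite (partition_big colengths (fun f => comps (level f 0) == 1%N)) /=; last first.
  by move=> x; rewrite suppE.
rewrite [RHS](eq_bigr (fun E : {set arr Q} =>
  \sum_(f : {ffun arr Q -> 'I_n.+2} | level f 0 == E)
   c ^ betti (subquiver (level f 0)) * \prod_(k < n.+1) codim_weight q (level f k)));
     last first.
  move=> E _; rewrite -sum_levels -sum_levels_rec big_distrr /=.
  by apply: eq_bigr => f /eqP ->.
rewrite [LHS](partition_big (fun f : {ffun arr Q -> 'I_n.+2} => level f 0) (fun E =>
  comps E == 1%N)) //=.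
apply: eq_bigr => E /eqP E1; apply: eq_big => [f|f /andP[_ /eqP fE]].
  by case: (level f 0 =P E) => [->|_]; rewrite ?E1 ?andbF.
rewrite (eq_bigl [pred x | colengths x == f]); last first.
  move=> x /=; rewrite suppE; case: (colengths x =P f) => [->|_].
    by rewrite fE E1.
  by rewrite andbF.
transitivity (#|[pred x | colengths x == f]|%:R * (q ^ (- (n.+1%:Z * betti Q)) *
    ((c * \prod_(k < n.+1) q ^+ comps (level f k)) / #|@gauge Q F n|%:R))).
  rewrite [RHS]mulr_natl -[RHS]sumr_const; apply: eq_big => // x /eqP xf.
  by rewrite card_stab xf // fE E1.
rewrite card_colengths card_gauge.
have -> : q ^ (- (n.+1%:Z * betti Q)) = \prod_(k < n.+1) q ^ (- betti Q).
  by rewrite prodr_const card_ord exprnP exprz_exp; congr (_ ^ _); lia.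
have cwE k : codim_weight q (level f k) = q ^+ comps (level f k) / q ^+ #|vert Q|
    * q ^+ #|level f k| * q ^ (- betti Q).
  by rewrite /codim_weight bettiE !expfzDr // -exprnN.
under [X in _ = _ * X]eq_bigr do rewrite cwE.
rewrite !big_split /= prodfV fE bettiE E1 !expfzDr // expr1z -exprnN invfM.
rewrite -[_ ^ #|E|]exprnP.
move: (\prod_(k < n.+1) q ^+ #|level f k|) (\prod_(k < n.+1) q ^ (- betti Q))
  (\prod_(k < n.+1) q ^+ comps (level f k)) (\prod_(k < n.+1) q ^+ #|vert Q|)^-1.
move: (c ^+ #|E|) (c ^- #|vert Q|) (c) => c1 c2 c3 p1 p2 p3 p4; ring.
Qed.

End Count.

(** * The limit and the Hilbert series *)

Section Hilbert.
Context (R : realType) (Q : quiver) (hQ : two_connected Q).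

Definition codim (E : {set arr Q}) : nat := `|betti Q - betti (subquiver E)|%N.

Lemma codim_gt0 (E : {set arr Q}) : E \proper setT -> (0 < codim E)%N.
Proof. by move=> /(betti_proper hQ); rewrite /codim; lia. Qed.

Lemma codim_weightE (q : R) (E : {set arr Q}) : codim_weight q E = (q ^+ codim E)^-1.
Proof.
rewrite /codim_weight -[RHS]/(q ^- codim E) exprnN /codim; congr (_ ^ _).
have := betti_subset (subsetT E); rewrite bettiT; lia.
Qed.

Lemma codim_weight_bounds (q : R) (E : {set arr Q}) : 1 < q -> E \proper setT ->
  0 <= codim_weight q E < 1.
Proof.
move=> q1 ET; rewrite codim_weightE.
have qd : 1 < q ^+ codim E by rewrite exprn_egt1 // -lt0n codim_gt0.
by rewrite invr_ge0 (le_trans ler01 (ltW qd)) invf_lt1 // (lt_trans ltr01).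
Qed.

Lemma geom_weight_codim (q : R) (E : {set arr Q}) : 1 < q -> E \proper setT ->
  codim_weight q E / (1 - codim_weight q E) = geom_weight codim q E.
Proof.
move=> q1 ET; rewrite codim_weightE /geom_weight.
have qd : 1 < q ^+ codim E by rewrite exprn_egt1 // -lt0n codim_gt0.
have q0 : q ^+ codim E != 0 by rewrite gt_eqF // (lt_trans ltr01).
have q1' : q ^+ codim E - 1 != 0 by rewrite gt_eqF // subr_gt0.
rewrite -invfM; congr (_^-1).
by rewrite mulrBr mulr1 mulfV.
Qed.

(** The Hilbert series as a function of a set [E], to be used at the set of all
    arrows; its weights are [u / (1 - u)] for [u = q ^- codim E]. *)
Definition hilb (q : R) : {set arr Q} -> R := chain_sum (geom_weight codim q).

Lemma hilb_rec (q : R) : 1 < q ->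
  chain_recursion (fun X => codim_weight q X / (1 - codim_weight q X)) (hilb q).
Proof.
move=> q1 E; rewrite /hilb chain_sumE; congr (_ + _); apply: eq_bigr => X /andP[_ XE].
by rewrite geom_weight_codim // (proper_sub_trans XE) ?subsetT.
Qed.

Lemma Hilb_atE (q : R) : 1 < q -> Hilb_at Q q = (hilb q setT)%:E.
Proof.
move=> q1; have wE (X : proper_part (arr Q)) :
    q ^ (- (betti Q - betti (subquiver (val X)))) = codim_weight q (val X).
  by rewrite /codim_weight opprB.
have XT (X : proper_part (arr Q)) : val X \proper setT.
  by rewrite properT; case/andP: (valP X).
rewrite /Hilb_at fine_HilbE; first last.
- by move=> X; rewrite wE codim_weight_bounds.
- move=> C C' /fintype.subsetP CC'; rewrite !inE => /forall_inP hC.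
  by apply/forall_inP => X XC; apply/forall_inP => Y YC;
    move/forall_inP: (hC X (CC' X XC)); apply; apply: CC'.
rewrite /hilb /chain_sum; congr _%:E; apply: eq_big => [C|C _].
  by rewrite andb_idr // => _; apply/forall_inP => X _; exact: XT.
by apply: eq_bigr => X _; rewrite wE geom_weight_codim.
Qed.

End Hilbert.

Lemma connected_vertex (Q : quiver) : quiver_connected Q -> vert Q.
Proof.
move=> cQ; have : (0 < #|vert Q|)%N.
  rewrite -comps0; apply: leq_trans (comps_subset (sub0set setT)).
  by rewrite compsT cQ.
by case: (pickP (@predT (vert Q))) => // h0; rewrite eq_card0.
Qed.

(** Of the finite sum over E_0 only the term of the full set has a non-zero
    limit. *)
Lemma cvg_normalized_count (R : realType) (Q : quiver) (F : finFieldType) :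
  two_connected Q -> (0 < #|arr Q|)%N ->
  let q : R := #|F|%:R in
  normalized_count R Q F @ \oo -->
    (1 - q^-1) ^ betti Q * (hilb q [set: arr Q]%SET / (1 - q ^ (- betti Q))).
Proof.
move=> hQ arr0 q.
have q1 : 1 < q := card_field_gt1 R F.
have uT : codim_weight q [set: arr Q] = 1 by rewrite /codim_weight bettiT subrr.
have ub := fun E => codim_weight_bounds (E := E) hQ q1.
have c1 : comps [set: arr Q] == 1%N by rewrite compsT; apply/eqP; exact: hQ.1.
pose term n (E : {set arr Q}) := (1 - q^-1) ^ betti (subquiver E)
  * (codim_weight q E * multichain_sum (codim_weight q) n E).
have countE : (fun n => normalized_count R Q F n.+1) = fun n => term n [set: arr Q]%SET +
   \sum_(E : {set arr Q} | (comps E == 1%N) && (E != [set: arr Q]%SET)) term n E.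
  apply/funext => n; rewrite (normalized_countE R F _ (connected_vertex hQ.1)).
  by rewrite (bigD1 [set: arr Q]%SET).
set L := _ * _; suff : (fun n => normalized_count R Q F n.+1) @ \oo --> L + 0.
  by rewrite addr0 (cvg_shiftS (normalized_count R Q F)).
rewrite countE; apply: cvgD.
  rewrite /term bettiT uT /L.
  under eq_fun do rewrite mul1r.
  apply: cvgMr; rewrite -[- betti Q]add0r -(betti0 Q) -/(codim_weight q set0).
  by apply: cvg_multichain_setT => //; exact: hilb_rec.
pose P (E : {set arr Q}) := (comps E == 1%N) && (E != [set: arr Q]%SET).
have lim0 : (fun n => \sum_(E : {set arr Q} | P E) term n E) @ \oo -->
    \sum_(E : {set arr Q} | P E) (1 - q^-1) ^ betti (subquiver E) * (codim_weight q E * 0).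
  apply: cvg_big => [|E /andP[_ ET]]; first exact: add_continuous.
  apply: cvgMr; apply: cvgMr; apply: (cvg_multichain_proper uT ub (hilb_rec hQ q1)).
  by rewrite properT.
by move: lim0; rewrite [in X in X -> _]big1 // => E _; rewrite !mulr0.
Qed.

(** Without arrows the only multichain is constant of weight [1]. *)
Lemma cvg_normalized_count_no_arrow (R : realType) (Q : quiver) (F : finFieldType) :
  two_connected Q -> #|arr Q| = 0%N -> cvgn (normalized_count R Q F).
Proof.
move=> hQ arr0; set q : R := #|F|%:R.
have allT (E : {set arr Q}) : E = setT.
  by apply/setP => a; have := card0_eq arr0 a; rewrite inE.
have uT (E : {set arr Q}) : codim_weight q E = 1 by rewrite (allT E) /codim_weight
  bettiT subrr.
have Z1 n (E : {set arr Q}) : multichain_sum (codim_weight q) n E = 1.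
  elim: n E => //= n IH E; rewrite (eq_bigr (fun=> 1)) => [|X _];
    last by rewrite uT IH mulr1.
  by rewrite (big_pred1 E) // => X /=; rewrite (allT X) (allT E) eqxx subxx.
suff : cvgn (fun n => normalized_count R Q F n.+1).
  by move=> /cvg_ex[l]; rewrite (cvg_shiftS (normalized_count R Q F)) => hl;
    apply/cvg_ex; exists l.
under eq_fun do rewrite (normalized_countE R F _ (connected_vertex hQ.1)).
under eq_fun do under eq_bigr do rewrite Z1.
exact: is_cvg_cst.
Qed.

Theorem theorem1p0p4 (R : realType) (Q : quiver) (hQ : two_connected Q) :
  (forall F : finFieldType,
     let q : R := #|F|%:R in
     cvgn (normalized_count R Q F) /\
     (0 < betti Q ->
      (A_Q R Q F)%:E =
      (((1 - q^-1) ^ betti Q / (1 - q ^ (- betti Q)))%:E * Hilb_at Q q)%E)) /\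
  (exists N D : {poly int},
     [/\ forall i : nat, 0 <= N`_i,
         D != 0 &
         forall q : R, 1 < q ->
           Hilb_at Q q = ((map_poly intr N).[q] / (map_poly intr D).[q])%:E]).
Proof.
split=> [F q|]; last first.
  have [|N [D [N0 D0 ND]]] := @nonneg_numerator R _ (@codim Q) (codim_gt0 hQ) (@hilb R Q).
    by move=> q q1; exact: chain_sumE.
  exists N, D; split=> // q q1; rewrite (Hilb_atE hQ q1) ND //.
have q1 : 1 < q := card_field_gt1 R F.
have [arr0|arr_gt0] := posnP #|arr Q|.
  split; last first.
    have := hQ.1; rewrite /quiver_connected /betti arr0 => ->.
    have : (0 < #|vert Q|)%N by apply/card_gt0P; exists (connected_vertex hQ.1).
    lia.
  exact: cvg_normalized_count_no_arrow.
have lim := @cvg_normalized_count R Q F hQ arr_gt0; split.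
  by apply/cvg_ex; eexists; exact: lim.
move=> _; rewrite /A_Q (cvg_lim _ lim) // (Hilb_atE hQ q1) -EFinM.
by congr _%:E; rewrite mulrA mulrAC.
Qed.
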